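(* Consider the Lasso problem of minimizing $\varphi(x):=\frac12\|Ax-b\|_2^2+\mu\|x\|_1$ over $x\in\mathbb{R}^n$, where $A\in\mathbb{R}^{m\times n}$, $b\in\mathbb{R}^m$, $\mu>0$, and suppose that $A^*A$ is positive-definite. Write $\varphi(x)=\frac12\langle\bar Ax,x\rangle+\langle\bar b,x\rangle+\bar\alpha+g(x)$ with $\bar A:=A^*A$, $\bar b:=-A^*b$, $\bar\alpha:=\frac12\|b\|^2$, $g(x):=\mu\|x\|_1$. Then: (i) the Generalized Damped Newton Algorithm for Quadratic Composite Optimization applied with data $(\bar A,\bar b,g)$ is well-defined, and its sequence of iterates $\{y^k\}$ globally converges at least Q-superlinearly to some $\bar y$; (ii) $\bar x:=Q\bar y+c$ is the unique solution of the Lasso problem and is a tilt-stable local minimizer of $\varphi$.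
   Context: Moreau envelope and proximal map of $g$ with $\gamma>0$: $e_\gamma g(x):=\inf_y\{g(y)+\frac1{2\gamma}\|y-x\|^2\}$, $\operatorname{Prox}_{\gamma g}(x):=\operatorname{argmin}_y\{g(y)+\frac1{2\gamma}\|y-x\|^2\}$. Generalized Damped Newton Algorithm for Quadratic Composite Optimization with data $(\bar A,\bar b,g)$: parameters $\sigma\in(0,\tfrac12)$, $\beta\in(0,1)$. Choose $\gamma>0$ with $I-\gamma\bar A$ positive-definite; set $Q:=(I-\gamma\bar A)^{-1}$, $c:=\gamma Q\bar b$, $P:=Q-I$, $\psi(y):=\frac12\langle Py,y\rangle+\langle c,y\rangle+\gamma e_\gamma g(y)$ (so $\nabla\psi(y)=Qy-\operatorname{Prox}_{\gamma g}(y)+c$). Choose $y^0$, $k=0$. If $\nabla\psi(y^k)=0$ stop; else set $v^k:=\operatorname{Prox}_{\gamma g}(y^k)$ and find $d^k$ with $\frac1\gamma(-\nabla\psi(y^k)-Pd^k)\in\partial^2g\big(v^k,\frac1\gamma(y^k-v^k)\big)(Qd^k+\nabla\psi(y^k))$; set $\tau_k=1$ and while $\psi(y^k+\tau_kd^k)>\psi(y^k)+\sigma\tau_k\langle\nabla\psi(y^k),d^k\rangle$ replace $\tau_k$ by $\beta\tau_k$; set $y^{k+1}:=y^k+\tau_kd^k$, increase $k$, repeat. Here $\partial^2g(x,y)(w):=\{z\mid(z,-w)\in N_{\operatorname{gph}\partial g}(x,y)\}$ with $N$ the limiting normal cone: $N_\Omega(\bar z)$ consists of $v$ such that $z_k\to\bar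 z$, $z_k\in\Omega$, $v_k\to v$, $v_k\in\widehat N_\Omega(z_k)$, with $\widehat N_\Omega(\bar z):=\{v\mid\limsup_{z\to\bar z,z\in\Omega}\langle v,z-\bar z\rangle/\|z-\bar z\|\le0\}$. Tilt stability: $\bar x$ is a tilt-stable local minimizer of $\varphi$ if for some $\gamma'>0$ the map $v\mapsto\operatorname{argmin}\{\varphi(x)-\langle v,x\rangle\mid x\in\mathbb{B}_{\gamma'}(\bar x)\}$ is single-valued and Lipschitz near $0$ with value $\{\bar x\}$ at $0$. Q-superlinear: $\|y^{k+1}-\bar y\|/\|y^k-\bar y\|\to0$. *)

(* Defs.v *)
From HB Require Import structures.
From mathcomp Require Import all_boot all_order all_algebra.
From mathcomp Require Import all_classical all_reals all_analysis.
Set Implicit Arguments. Unset Strict Implicit. Unset Printing Implicit Defensive.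
Import Order.TTheory GRing.Theory Num.Theory.
Import numFieldNormedType.Exports.
Local Open Scope classical_set_scope.
Local Open Scope ring_scope.

Section Defs.
Variable R : realType.

Definition dot (N : nat) (u v : 'cV[R]_N) : R := \sum_(i < N) u i 0 * v i 0.
Definition enorm (N : nat) (u : 'cV[R]_N) : R := Num.sqrt (dot u u).
Definition l1norm (N : nat) (u : 'cV[R]_N) : R := \sum_(i < N) `|u i 0|.

Definition posdef (N : nat) (M : 'M[R]_N) : Prop :=
  forall x : 'cV[R]_N, x != 0 -> 0 < dot (M *m x) x.

Definition seq_cvg (N : nat) (u : nat -> 'cV[R]_N) (l : 'cV[R]_N) : Prop :=
  forall e : R, 0 < e -> exists K : nat, forall k, (K <= k)%N -> enorm (u k - l) < e.

Definition Qsuperlinear (N : nat) (y : nat -> 'cV[R]_N) (ybar : 'cV[R]_N) : Prop :=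
  (fun k => enorm (y k.+1 - ybar) / enorm (y k - ybar)) @ \oo --> (0 : R).

Definition moreau (N : nat) (g : 'cV[R]_N -> R) (gam : R) (x : 'cV[R]_N) : R :=
  inf [set g y + (2 * gam)^-1 * (enorm (y - x)) ^+ 2 | y in [set: 'cV[R]_N]].
Definition prox_set (N : nat) (g : 'cV[R]_N -> R) (gam : R) (x : 'cV[R]_N)
  : set 'cV[R]_N :=
  [set y | forall y', g y + (2 * gam)^-1 * (enorm (y - x)) ^+ 2
                       <= g y' + (2 * gam)^-1 * (enorm (y' - x)) ^+ 2].
(* Prox_{gam g}(x) as a point (a chosen element of the argmin set; the argmin
   is a singleton when g is convex and lsc) *)
Definition prox (N : nat) (g : 'cV[R]_N -> R) (gam : R) (x : 'cV[R]_N) : 'cV[R]_N :=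
  xget 0 (prox_set g gam x).

Definition frechet_normal (N : nat) (Om : set 'cV[R]_N) (zb : 'cV[R]_N)
  : set 'cV[R]_N :=
  [set v | forall e : R, 0 < e -> exists d : R, 0 < d /\
      forall z, Om z -> enorm (z - zb) < d -> dot v (z - zb) <= e * enorm (z - zb)].
Definition limiting_normal (N : nat) (Om : set 'cV[R]_N) (zb : 'cV[R]_N)
  : set 'cV[R]_N :=
  [set v | exists (z vs : nat -> 'cV[R]_N),
      (forall k, Om (z k)) /\ seq_cvg z zb /\ seq_cvg vs v /\
      (forall k, frechet_normal Om (z k) (vs k))].

Definition regular_subdiff (N : nat) (g : 'cV[R]_N -> R) (x : 'cV[R]_N)
  : set 'cV[R]_N :=
  [set v | forall e : R, 0 < e -> exists d : R, 0 < d /\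
      forall u, enorm (u - x) < d -> g u - g x - dot v (u - x) >= - e * enorm (u - x)].
Definition limiting_subdiff (N : nat) (g : 'cV[R]_N -> R) (x : 'cV[R]_N)
  : set 'cV[R]_N :=
  [set v | exists (xs vs : nat -> 'cV[R]_N),
      seq_cvg xs x /\ ((fun k => g (xs k)) @ \oo --> g x) /\ seq_cvg vs v /\
      (forall k, regular_subdiff g (xs k) (vs k))].

Definition gph_subdiff (N : nat) (g : 'cV[R]_N -> R) : set 'cV[R]_(N + N) :=
  [set p | exists x v, limiting_subdiff g x v /\ p = col_mx x v].

Definition subdiff2 (N : nat) (g : 'cV[R]_N -> R) (x y w : 'cV[R]_N)
  : set 'cV[R]_N :=
  [set z | limiting_normal (gph_subdiff g) (col_mx x y) (col_mx z (- w))].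

Section GDNA.
Variables (N : nat) (Ab : 'M[R]_N) (bb : 'cV[R]_N) (g : 'cV[R]_N -> R).
Variables (sigma beta gam : R).

Definition gQ : 'M[R]_N := invmx (1%:M - gam *: Ab).
Definition gc : 'cV[R]_N := gam *: (gQ *m bb).
Definition gP : 'M[R]_N := gQ - 1%:M.
Definition psi (y : 'cV[R]_N) : R :=
  2^-1 * dot (gP *m y) y + dot gc y + gam * moreau g gam y.
Definition grad_psi (y : 'cV[R]_N) : 'cV[R]_N := gQ *m y - prox g gam y + gc.

Definition newton_dir (y d : 'cV[R]_N) : Prop :=
  let v := prox g gam y in
  subdiff2 g v (gam^-1 *: (y - v)) (gQ *m d + grad_psi y)
    (gam^-1 *: (- grad_psi y - gP *m d)).

Definition armijo (y d : 'cV[R]_N) (t : R) : Prop :=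
  psi (y + t *: d) <= psi y + sigma * t * dot (grad_psi y) d.

(* one step k of the algorithm on sequences (y, d, tau); once the stopping
   test grad psi(y^k) = 0 fires, the sequence is frozen (y^{k+1} = y^k) *)
Definition gdna_step (y d : nat -> 'cV[R]_N) (tau : nat -> R) (k : nat) : Prop :=
  (grad_psi (y k) = 0 -> y k.+1 = y k) /\
  (grad_psi (y k) <> 0 ->
     newton_dir (y k) (d k) /\
     (exists j : nat, tau k = beta ^+ j /\ armijo (y k) (d k) (beta ^+ j) /\
        forall i : nat, (i < j)%N -> ~ armijo (y k) (d k) (beta ^+ i)) /\
     y k.+1 = y k + tau k *: d k).
End GDNA.

Definition argmin_ball (N : nat) (phi : 'cV[R]_N -> R) (xb : 'cV[R]_N) (r : R)
  (v : 'cV[R]_N) : set 'cV[R]_N :=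
  [set x | enorm (x - xb) <= r /\
     forall x', enorm (x' - xb) <= r -> phi x - dot v x <= phi x' - dot v x'].
Definition tilt_stable (N : nat) (phi : 'cV[R]_N -> R) (xb : 'cV[R]_N) : Prop :=
  exists r : R, 0 < r /\
  exists (M : 'cV[R]_N -> 'cV[R]_N) (delta L : R), 0 < delta /\ 0 <= L /\
    (forall v, enorm v < delta -> argmin_ball phi xb r v = [set M v]) /\
    (forall v v', enorm v < delta -> enorm v' < delta ->
        enorm (M v - M v') <= L * enorm (v - v')) /\
    M 0 = xb.

Definition lasso (m n : nat) (A : 'M[R]_(m, n)) (b : 'cV[R]_m) (mu : R)
  (x : 'cV[R]_n) : R := 2^-1 * (enorm (A *m x - b)) ^+ 2 + mu * l1norm x.
End Defs.

(* Main.v *)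
Require Import Defs.
From HB Require Import structures.
From mathcomp Require Import all_boot all_order all_algebra.
From mathcomp Require Import all_classical all_reals all_analysis.
From mathcomp Require Import ring lra.
Set Implicit Arguments.
Unset Strict Implicit.
Unset Printing Implicit Defensive.
Import Order.TTheory GRing.Theory Num.Theory.
Import numFieldNormedType.Exports.
Local Open Scope classical_set_scope.
Local Open Scope ring_scope.

(** For g = mu |.|_1 the proximal map is soft thresholding at level lam = gam mu, so
    grad psi (y) = Q y - soft (y) + c is piecewise affine.  Computing the limiting
    normals to the graph of the subdifferential of g shows that a Newton direction
    solves (Q - T) d = - grad psi (y), where T is diagonal with entries in [0, 1],
    equal to 1 where |y_i| > lam and to 0 where |y_i| < lam.  Since Q - I is positive
    definite, directions exist, are descent directions, and the accepted step sizes
    are bounded below.  Hence psi drops by a fixed amount as long as the iterates stay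
    away from the zero yb of grad psi.  Close to yb, the affine piece of grad psi at y
    also contains yb, so the Newton equation is exact: y + d = yb, and the unit step
    passes the Armijo test because psi is quadratic on [y, yb] and sigma < 1/2.
    Every run therefore reaches yb after finitely many steps.  Finally
    grad psi (yb) = 0 is the optimality condition of the Lasso problem at
    Q yb + c = prox (yb), and applying this to tilted data gives strong minimizers of
    all linear perturbations, whence tilt stability. *)

(** * Euclidean vectors and positive definite matrices *)

Section Euclid.
Variables (R : realType) (n : nat).
Implicit Types (x y z : 'cV[R]_n) (M : 'M[R]_n).

Lemma dotC x y : dot x y = dot y x.
Proof. by apply: eq_bigr => i _; rewrite mulrC. Qed.

Lemma dotDl x y z : dot (x + y) z = dot x z + dot y z.
Proof. by rewrite -big_split; apply: eq_bigr => i _; rewrite mxE mulrDl. Qed.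

Lemma dotZl a x y : dot (a *: x) y = a * dot x y.
Proof. by rewrite mulr_sumr; apply: eq_bigr => i _; rewrite mxE mulrA. Qed.

Lemma dotNl x y : dot (- x) y = - dot x y.
Proof. by rewrite -scaleN1r dotZl mulN1r. Qed.

Lemma dotBl x y z : dot (x - y) z = dot x z - dot y z.
Proof. by rewrite dotDl dotNl. Qed.

Lemma dotDr x y z : dot x (y + z) = dot x y + dot x z.
Proof. by rewrite ![dot x _]dotC dotDl. Qed.

Lemma dotZr a x y : dot x (a *: y) = a * dot x y.
Proof. by rewrite ![dot x _]dotC dotZl. Qed.

Lemma dotNr x y : dot x (- y) = - dot x y.
Proof. by rewrite ![dot x _]dotC dotNl. Qed.

Lemma dotBr x y z : dot x (y - z) = dot x y - dot x z.
Proof. by rewrite dotDr dotNr. Qed.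

Lemma dot0l x : dot 0 x = 0.
Proof. by rewrite -(scale0r x) dotZl mul0r. Qed.

Lemma dot0r x : dot x 0 = 0.
Proof. by rewrite dotC dot0l. Qed.

Definition dotE := (dotDl, dotDr, dotBl, dotBr, dotNl, dotNr, dotZl, dotZr).

Lemma dot_ge0 x : 0 <= dot x x.
Proof. by apply: sumr_ge0 => i _; rewrite -expr2 sqr_ge0. Qed.

Lemma coord_sqr_le x i : x i 0 ^+ 2 <= dot x x.
Proof.
rewrite /dot (bigD1 i) //= -expr2 lerDl; apply: sumr_ge0 => j _.
by rewrite -expr2 sqr_ge0.
Qed.

Lemma dot_eq0 x : dot x x <= 0 -> x = 0.
Proof.
move=> x0; apply/matrixP => i j; rewrite ord1 mxE; apply/eqP.
rewrite -sqrf_eq0 eq_le sqr_ge0 andbT; exact: le_trans (coord_sqr_le x i) x0.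
Qed.

Lemma dot_gt0 x : x != 0 -> 0 < dot x x.
Proof.
move=> x0; rewrite lt_neqAle dot_ge0 andbT eq_sym; apply: contra x0 => /eqP x0.
by apply/eqP/dot_eq0; rewrite x0.
Qed.

Lemma enorm_sqr x : enorm x ^+ 2 = dot x x.
Proof. by rewrite sqr_sqrtr ?dot_ge0. Qed.

Lemma enorm_ge0 x : 0 <= enorm x.
Proof. exact: sqrtr_ge0. Qed.

Lemma enorm0 : enorm (0 : 'cV[R]_n) = 0.
Proof. by rewrite /enorm dot0l sqrtr0. Qed.

Lemma enorm_lt x (e : R) : 0 < e -> (enorm x < e) = (dot x x < e ^+ 2).
Proof. by move=> e0; rewrite -enorm_sqr ltr_pXn2r ?nnegrE ?enorm_ge0 ?ltW. Qed.

Lemma coord_le_enorm x i : `|x i 0| <= enorm x.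
Proof. by rewrite -sqrtr_sqr ler_wsqrtr ?coord_sqr_le. Qed.

Lemma enormZ (a : R) x : enorm (a *: x) = `|a| * enorm x.
Proof. by rewrite /enorm dotZl dotZr mulrA -expr2 sqrtrM ?sqr_ge0 // sqrtr_sqr. Qed.

(** Cauchy-Schwarz, from the nonnegative squared norm of [x] minus its projection on [y]. *)
Lemma dot_le_enorm x y : dot x y <= enorm x * enorm y.
Proof.
have [->|y0] := eqVneq y 0; first by rewrite dot0r enorm0 mulr0.
have yy := dot_gt0 y0.
have := dot_ge0 (x - (dot x y / dot y y) *: y); rewrite !dotE (dotC y x).
rewrite [X in 0 <= X](_ : _ = dot x x - dot x y ^+ 2 / dot y y); last first.
  by field; rewrite gt_eqF.
rewrite subr_ge0 ler_pdivrMr // -!enorm_sqr -exprMn => h.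
apply: le_trans (ler_norm _) _.
by rewrite -(@ler_pXn2r _ 2) ?nnegrE ?mulr_ge0 ?enorm_ge0 // real_normK ?num_real.
Qed.

Lemma dot_mulmxl (p : nat) (M : 'M[R]_(n, p)) (u : 'cV[R]_p) x :
  dot (M *m u) x = dot u (M^T *m x).
Proof.
rewrite /dot; under eq_bigr => i _ do rewrite mxE mulr_suml.
rewrite exchange_big; apply: eq_bigr => j _ /=.
rewrite mxE mulr_sumr; apply: eq_bigr => i _; rewrite mxE; ring.
Qed.

Lemma quadratic_form_bound M :
  exists C : R, 0 < C /\ forall x, dot (M *m x) x <= C * dot x x.
Proof.
exists (1 + \sum_i \sum_j `|M i j|); split.
  by rewrite ltr_wpDr // sumr_ge0 // => i _; rewrite sumr_ge0.
move=> x; rewrite mulrDl mul1r ler_wpDl ?dot_ge0 // {1}/dot mulr_suml.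
apply: ler_sum => i _; rewrite mxE mulr_suml mulr_suml.
apply: ler_sum => j _; rewrite -mulrA; apply: le_trans (ler_norm _) _.
rewrite normrM ler_wpM2l // ler_norml.
by have hi := coord_sqr_le x i; have hj := coord_sqr_le x j; nra.
Qed.

Lemma posdef_unitmx M : posdef M -> M \in unitmx.
Proof.
move=> Mpos; rewrite -unitmx_tr -row_free_unit; apply: inj_row_free => v vM.
have [/(congr1 trmx)|v0] := eqVneq v^T 0; first by rewrite trmxK trmx0.
by have := Mpos _ v0; rewrite -[M]trmxK -trmx_mul vM trmx0 dot0l ltxx.
Qed.

(* With z = M^-1 x, positivity of the form at x - z / C and <x, z> <= C <x, x>
   give the bound without any compactness argument. *)
Lemma posdef_coercive M : M^T = M -> posdef M ->
  exists k : R, 0 < k /\ forall x, k * dot x x <= dot (M *m x) x.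
Proof.
move=> Msym Mpos; have Mu := posdef_unitmx Mpos.
have [C [C0 hC]] := quadratic_form_bound (invmx M).
exists C^-1; split; first by rewrite invr_gt0.
move=> x; set z := invmx M *m x.
have Mz : M *m z = x by rewrite mulmxA mulmxV // mul1mx.
have : 0 <= dot (M *m (x - C^-1 *: z)) (x - C^-1 *: z).
  have [->|u0] := eqVneq (x - C^-1 *: z) 0; first by rewrite dot0r.
  exact/ltW/Mpos.
have Mxz : dot (M *m x) z = dot x x by rewrite dot_mulmxl Msym Mz.
rewrite mulmxBr -scalemxAr Mz !dotE Mxz [dot x z]dotC.
set a := C^-1; have Ca : C * a = 1 by rewrite mulfV ?gt_eqF.
have a0 : 0 < a by rewrite invr_gt0.
set D := dot (M *m x) x.
have hz : dot z x <= C * dot x x := hC x.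
have : a * (a * dot z x) <= a * dot x x.
  rewrite ler_pM2l //; apply: le_trans (_ : a * (C * dot x x) <= _).
    by rewrite ler_pM2l.
  by rewrite mulrA [a * C]mulrC Ca mul1r.
lra.
Qed.

Lemma seq_cvg_coord (u : nat -> 'cV[R]_n) l i : seq_cvg u l ->
  (fun k => u k i 0) @ \oo --> l i 0.
Proof.
move=> ul; apply/cvgrPdist_lt => e e0; have [K hK] := ul e e0.
near=> k; rewrite distrC; apply: le_lt_trans (hK k _); last by near: k; exists K.
by apply: le_trans (coord_le_enorm _ i); rewrite !mxE.
Unshelve. all: by end_near. Qed.

Lemma euclid_complete (u : nat -> 'cV[R]_n) :
  (forall e : R, 0 < e -> exists K, forall k l, (K <= k)%N -> (K <= l)%N ->
     enorm (u k - u l) < e) ->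
  exists l, seq_cvg u l.
Proof.
move=> hu.
have cv i : cvg ((fun k => u k i 0) @ \oo).
  apply/cauchy_cvgP/cauchy_exP => e /= e0; have [K hK] := hu _ e0.
  exists (u K i 0); exists K => // k /= Kk.
  rewrite /ball /=; apply: le_lt_trans (hK K k _ _) => //.
  by apply: le_trans (coord_le_enorm _ i); rewrite !mxE.
exists (\col_i lim ((fun k => u k i 0) @ \oo)) => e e0.
set l := \col_i _.
have : (fun k => dot (u k - l) (u k - l)) @ \oo --> (0 : R).
  rewrite -[X in _ --> X](_ : \sum_(i < n) (0 : R) * 0 = 0); last first.
    by rewrite big1 // => i _; rewrite mul0r.
  apply: cvg_big => [|i _]; first exact: add_continuous.
  have h : (fun k => (u k - l) i 0) @ \oo --> (0 : R).
    rewrite (_ : (fun k => _) = (fun k => u k i 0 - l i 0)); last first.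
      by apply/funext => k; rewrite !mxE.
    by apply/subr_cvg0; rewrite /l mxE; exact: cv.
  exact: cvgM.
move=> /cvgrPdist_lt /(_ (e ^+ 2)); rewrite exprn_gt0 // => /(_ isT) [K _ hK].
exists K => k Kk; rewrite enorm_lt //; have := hK k Kk.
by rewrite /= sub0r normrN ger0_norm ?dot_ge0.
Qed.

End Euclid.

(** Lets coordinatewise local statements share one radius: finitely many positive radii have a
    positive minimum. *)
Lemma common_radius (R : realType) (I : finType) (P : I -> R -> Prop) :
  (forall i d d', P i d -> d' <= d -> P i d') ->
  (forall i, exists d : R, 0 < d /\ P i d) ->
  exists d : R, 0 < d /\ forall i, P i d.
Proof.
move=> Pmono /choice [f hf]; exists (\big[Num.min/1]_i f i); split.
  by apply: (big_ind (fun x : R => 0 < x)) => // [x y x0 y0|i _];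
    [rewrite lt_min x0 | case: (hf i)].
by move=> i; apply: Pmono (hf i).2 _; exact: bigmin_le_cond.
Qed.

(** * Soft thresholding *)

Section SoftThreshold.
Variables (R : realType) (lam : R).
Hypothesis lam0 : 0 < lam.
Implicit Types (a s t : R).

Definition soft t := if lam < t then t - lam else if t < - lam then t + lam else 0.

(** Says that [a] is a subgradient of [lam * |.|] at [s]. The equation avoids a case split on the
    sign of [s] and survives limits. *)
Definition abs_subgrad a s : Prop := `|a| <= lam /\ a * s = lam * `|s|.

(** The minimum over [s] of [lam * |s| + (s - t)^2 / 2], written at its minimizer: the Huber
    function, with derivative [t - soft t]. *)
Definition huber t := lam * `|soft t| + 2^-1 * (t - soft t) ^+ 2.

Lemma soft_subgrad t : abs_subgrad (t - soft t) (soft t).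
Proof.
have l0 := lam0; rewrite /abs_subgrad /soft ler_norml; case: ltP => h1.
  by rewrite gtr0_norm ?subr_gt0 //; split; [apply/andP; split; lra|ring].
case: ltP => h2; last by rewrite normr0; split; [apply/andP; split; lra|ring].
by rewrite ltr0_norm; [split; [apply/andP; split; lra|ring]|lra].
Qed.

Lemma soft_eq0 t : `|t| <= lam -> soft t = 0.
Proof.
rewrite ler_norml /soft => /andP[h1 h2].
by rewrite !ltNge h2 h1.
Qed.

Lemma soft_neq0 t : lam < `|t| -> soft t != 0.
Proof.
have l0 := lam0; rewrite ltr_normr /soft => /orP h.
case: ltP => h1; first by rewrite subr_eq0 gt_eqF.
by case: ltP => h2; [rewrite addr_eq0 lt_eqF | case: h => ?; lra].
Qed.

Lemma abs_subgrad_le a s s' : abs_subgrad a s -> a * s' <= lam * `|s'|.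
Proof.
case=> ha _; apply: le_trans (ler_norm _) _; rewrite normrM.
exact: ler_wpM2r.
Qed.

Lemma soft_strong_min t s :
  huber t + 2^-1 * (s - soft t) ^+ 2 <= lam * `|s| + 2^-1 * (s - t) ^+ 2.
Proof.
have sg := soft_subgrad t; have := abs_subgrad_le s sg; case: sg => _.
rewrite /huber; set x := soft t => e h; nra.
Qed.

(** [soft t] is a competitor in the minimum that defines [huber t']. *)
Lemma huber_upper t t' :
  huber t' <= huber t + (t - soft t) * (t' - t) + 2^-1 * (t' - t) ^+ 2.
Proof.
have := soft_strong_min t' (soft t); have := sqr_ge0 (soft t - soft t').
rewrite /huber => h1 h2; nra.
Qed.

Lemma huber_lower t t' : huber t + (t - soft t) * (t' - t) <= huber t'.
Proof.
have sg := soft_subgrad t; have := abs_subgrad_le (soft t') sg; case: sg => _.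
have := sqr_ge0 ((t - soft t) - (t' - soft t')).
rewrite /huber; set x := soft t; set x' := soft t' => h e h'; nra.
Qed.

(** Add the subgradient inequalities at [soft t] and [soft t'], each tested at the other point. *)
Lemma soft_firmly_nonexpansive t t' :
  (soft t - soft t') ^+ 2 <= (soft t - soft t') * (t - t').
Proof.
have sg := soft_subgrad t; have sg' := soft_subgrad t'.
have := abs_subgrad_le (soft t') sg; have := abs_subgrad_le (soft t) sg'.
case: sg => _; case: sg' => _; set x := soft t; set x' := soft t' => *; nra.
Qed.

Lemma soft_ge t : lam <= t -> soft t = t - lam.
Proof. by have l0 := lam0; rewrite /soft; case: ltP => // h1 h2; case: ltP => h3; lra. Qed.

Lemma soft_le t : t <= - lam -> soft t = t + lam.
Proof. by have l0 := lam0; rewrite /soft; case: ltP => [|_] h1; [|case: ltP => h2]; lra. Qed.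

(* Near any tb, the piece of the graph through t also contains tb, so that soft
   is affine and huber quadratic on the whole segment [tb, t]. *)
Lemma soft_piecewise_affine tb : exists d : R, 0 < d /\ forall t, `|t - tb| < d ->
  [/\ lam < `|t| -> soft t - soft tb = t - tb,
      `|t| < lam -> soft t = soft tb,
      `|t| = lam -> t = tb &
      huber t - huber tb = 2^-1 * ((t - soft t) + (tb - soft tb)) * (t - tb)].
Proof.
have l0 := lam0.
have upper t : lam <= t -> lam <= tb ->
    [/\ lam < `|t| -> soft t - soft tb = t - tb, `|t| < lam -> soft t = soft tb &
    huber t - huber tb = 2^-1 * ((t - soft t) + (tb - soft tb)) * (t - tb)].
  move=> h h'; rewrite /huber !soft_ge // !ger0_norm ?subr_ge0 //; last lra.
  by split=> *; lra.
have lower t : t <= - lam -> tb <= - lam ->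
    [/\ lam < `|t| -> soft t - soft tb = t - tb, `|t| < lam -> soft t = soft tb &
    huber t - huber tb = 2^-1 * ((t - soft t) + (tb - soft tb)) * (t - tb)].
  move=> h h'; rewrite /huber !soft_le // !ler0_norm; try lra.
  by split=> *; lra.
have middle t : `|t| <= lam -> `|tb| <= lam ->
    [/\ lam < `|t| -> soft t - soft tb = t - tb, `|t| < lam -> soft t = soft tb &
    huber t - huber tb = 2^-1 * ((t - soft t) + (tb - soft tb)) * (t - tb)].
  move=> h h'; rewrite /huber !soft_eq0 // normr0.
  by split=> *; lra.
have conj4 (A B C D : Prop) : [/\ A, B & D] -> C -> [/\ A, B, C & D].
  by move=> [? ? ?] ?.
have abs_lam t : `|t| = lam -> t = lam \/ t = - lam.
  by move/eqP; rewrite eqr_norml => /andP[/orP[] /eqP]; [left|right].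
have [hb|hb|hb] := ltgtP `|tb| lam.
- exists (lam - `|tb|); split; first by rewrite subr_gt0.
  move=> t ht; have lt_t : `|t| < lam.
    by rewrite -[t](subrK tb); apply: le_lt_trans (ler_normD _ _) _; lra.
  by apply: conj4 => [|h]; [apply: middle; exact: ltW | lra].
- exists (`|tb| - lam); split; first by rewrite subr_gt0.
  move=> t; rewrite ltr_norml => /andP[h1 h2].
  move: hb; rewrite ltr_normr => /orP[] hb.
    rewrite gtr0_norm in h1 h2; last lra.
    by apply: conj4 => [|h]; [apply: upper | case: (abs_lam _ h)]; lra.
  rewrite ltr0_norm in h1 h2; last lra.
  by apply: conj4 => [|h]; [apply: lower | case: (abs_lam _ h)]; lra.
(* At a kink two pieces meet and both contain [tb]; the radius [lam] keeps [t] on the same side of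
   zero as [tb]. *)
- exists lam; split => // t; rewrite ltr_norml => /andP[h1 h2].
  have hb' : `|tb| <= lam by rewrite hb.
  apply: conj4 => [|h]; last by case: (abs_lam _ h) (abs_lam _ hb) => ? []; lra.
  have /orP[?|ht] : (`|t| <= lam) || (lam < `|t|) by case: leP.
    exact: middle.
  by rewrite ltr_normr in ht; case: (abs_lam _ hb) => e; case/orP: ht => ht;
    [apply: upper|exfalso|exfalso|apply: lower]; lra.
Qed.

End SoftThreshold.

(** * Proximal map and Moreau envelope of the l1 norm *)

Section Prox.
Variables (R : realType) (n : nat).
Implicit Types (x y s v : 'cV[R]_n) (lam gam mu : R).

Definition softv lam y : 'cV[R]_n := \col_i soft lam (y i 0).

Definition huberv lam y : R := \sum_i huber lam (y i 0).

Lemma prox_objective mu gam y s : 0 < gam ->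
  gam * (mu * l1norm s + (2 * gam)^-1 * enorm (s - y) ^+ 2) =
  \sum_i (gam * mu * `|s i 0| + 2^-1 * (s i 0 - y i 0) ^+ 2).
Proof.
move=> gam0; rewrite enorm_sqr big_split /= -!mulr_sumr mulrDr mulrA; congr (_ + _).
rewrite (_ : \sum_i _ = dot (s - y) (s - y)); last first.
  by apply: eq_bigr => i _; rewrite !mxE expr2.
by field; rewrite gt_eqF.
Qed.

Lemma prox_objective_softv mu gam y : 0 < gam ->
  gam * (mu * l1norm (softv (gam * mu) y)
         + (2 * gam)^-1 * enorm (softv (gam * mu) y - y) ^+ 2) =
  huberv (gam * mu) y.
Proof.
move=> gam0; rewrite prox_objective //; apply: eq_bigr => i _.
by rewrite mxE /huber -[(y i 0 - _) ^+ 2]sqrrN opprB.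
Qed.

Lemma softv_strong_min mu gam y s : 0 < gam -> 0 < mu ->
  huberv (gam * mu) y +
    2^-1 * dot (s - softv (gam * mu) y) (s - softv (gam * mu) y) <=
  gam * (mu * l1norm s + (2 * gam)^-1 * enorm (s - y) ^+ 2).
Proof.
move=> gam0 mu0; rewrite prox_objective // mulr_sumr -big_split /=.
apply: ler_sum => i _; rewrite !mxE -expr2.
by apply: soft_strong_min; rewrite mulr_gt0.
Qed.

(** Quadratic growth around [softv] makes the argmin a singleton, so the choice made by [xget] is
    forced. *)
Lemma prox_l1 mu gam y : 0 < gam -> 0 < mu ->
  prox (fun x => mu * l1norm x) gam y = softv (gam * mu) y.
Proof.
move=> gam0 mu0; apply: xget_unique => [s|s hs].
  rewrite -(ler_pM2l gam0) prox_objective_softv //.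
  apply: le_trans (softv_strong_min y s gam0 mu0).
  by rewrite lerDl mulr_ge0 ?dot_ge0 // invr_ge0.
apply/eqP; rewrite -subr_eq0; apply/eqP/dot_eq0.
have := hs (softv (gam * mu) y); rewrite -(ler_pM2l gam0) prox_objective_softv // => h.
by have := softv_strong_min y s gam0 mu0; lra.
Qed.

Lemma moreau_l1 mu gam y : 0 < gam -> 0 < mu ->
  gam * moreau (fun x => mu * l1norm x) gam y = huberv (gam * mu) y.
Proof.
move=> gam0 mu0; rewrite -prox_objective_softv //; congr (_ * _).
set p := softv _ _.
set f := fun s : 'cV[R]_n => mu * l1norm s + (2 * gam)^-1 * enorm (s - y) ^+ 2.
have lb : lbound [set f s | s in [set: 'cV[R]_n]] (f p).
  move=> _ [s _ <-]; rewrite -(ler_pM2l gam0) prox_objective_softv //.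
  apply: le_trans (softv_strong_min y s gam0 mu0).
  by rewrite lerDl mulr_ge0 ?dot_ge0 // invr_ge0.
apply/eqP; rewrite eq_le; apply/andP; split.
  by apply: ge_inf; [exists (f p) | exists p].
by apply: lb_le_inf => //; exists (f p), p.
Qed.

Lemma huberv_upper lam y y' : 0 < lam ->
  huberv lam y' <= huberv lam y + dot (y - softv lam y) (y' - y)
                   + 2^-1 * dot (y' - y) (y' - y).
Proof.
move=> lam0; rewrite /huberv /dot mulr_sumr -!big_split /=; apply: ler_sum => i _.
by rewrite !mxE; exact: huber_upper.
Qed.

Lemma huberv_lower lam y y' : 0 < lam ->
  huberv lam y + dot (y - softv lam y) (y' - y) <= huberv lam y'.
Proof.
move=> lam0; rewrite /huberv /dot -!big_split /=; apply: ler_sum => i _.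
by rewrite !mxE; exact: huber_lower.
Qed.

Lemma softv_firmly_nonexpansive lam y y' : 0 < lam ->
  dot (softv lam y - softv lam y') (softv lam y - softv lam y') <=
  dot (softv lam y - softv lam y') (y - y').
Proof.
move=> lam0; apply: ler_sum => i _; rewrite !mxE -expr2.
exact: soft_firmly_nonexpansive.
Qed.

(** The last identity is the trapezoidal rule, exact because [huberv] is quadratic on the segment
    from [yb] to [y]. *)
Lemma softv_piecewise_affine lam yb : 0 < lam ->
  exists d : R, 0 < d /\ forall y, enorm (y - yb) < d ->
  (forall i, [/\ lam < `|y i 0| -> soft lam (y i 0) - soft lam (yb i 0) = y i 0 - yb i 0,
      `|y i 0| < lam -> soft lam (y i 0) = soft lam (yb i 0) &
      `|y i 0| = lam -> y i 0 = yb i 0]) /\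
  huberv lam y - huberv lam yb =
    2^-1 * dot ((y - softv lam y) + (yb - softv lam yb)) (y - yb).
Proof.
move=> lam0.
have [|i|d [d0 hd]] := @common_radius R 'I_n (fun i d => forall t, `|t - yb i 0| < d ->
  [/\ lam < `|t| -> soft lam t - soft lam (yb i 0) = t - yb i 0,
      `|t| < lam -> soft lam t = soft lam (yb i 0),
      `|t| = lam -> t = yb i 0 &
      huber lam t - huber lam (yb i 0) =
      2^-1 * ((t - soft lam t) + (yb i 0 - soft lam (yb i 0))) * (t - yb i 0)]).
- by move=> i d d' h dd t ht; apply: h; exact: lt_le_trans dd.
- exact: soft_piecewise_affine.
exists d; split => // y hy.
have hc i : `|y i 0 - yb i 0| <= enorm (y - yb).
  by apply: le_trans (coord_le_enorm _ i); rewrite !mxE.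
have {}hd i := hd i (y i 0) (le_lt_trans (hc i) hy).
split=> [i|]; first by case: (hd i).
rewrite /huberv /dot mulr_sumr -sumrB; apply: eq_bigr => i _.
by case: (hd i) => _ _ _ ->; rewrite !mxE mulrA.
Qed.

End Prox.

(** * First-order subdifferential of the l1 norm *)

Section Subdifferential.
Variables (R : realType).

Lemma dot_delta (n : nat) (v : 'cV[R]_n) i : dot v (delta_mx i 0) = v i 0.
Proof.
rewrite /dot (bigD1 i) //= mxE !eqxx mulr1 big1 ?addr0 // => j ji.
by rewrite mxE (negPf ji) mulr0.
Qed.

Lemma enorm_delta (n : nat) (i : 'I_n) : enorm (delta_mx i 0 : 'cV[R]_n) = 1.
Proof. by rewrite /enorm dot_delta mxE !eqxx sqrtr1. Qed.

Lemma l1norm_delta (n : nat) (x : 'cV[R]_n) i t :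
  l1norm (x + t *: delta_mx i 0) - l1norm x = `|x i 0 + t| - `|x i 0|.
Proof.
rewrite /l1norm -sumrB (bigD1 i) //= !mxE !eqxx mulr1 big1 ?addr0 // => j ji.
by rewrite !mxE (negPf ji) mulr0 addr0 subrr.
Qed.

(** Coordinate perturbations suffice: a step along the sign of [v i] bounds [|v i|], and shrinking
    [x i] towards zero excludes a strict inequality [v i * x i < mu * |x i|]. *)
Lemma regular_subdiff_l1 (n : nat) (mu : R) (x v : 'cV[R]_n) : 0 < mu ->
  regular_subdiff (fun x => mu * l1norm x) x v ->
  forall i, abs_subgrad mu (v i 0) (x i 0).
Proof.
move=> mu0 hv i.
have test (e : R) : 0 < e -> exists d : R, 0 < d /\ forall t, `|t| < d ->
    - e * `|t| <= mu * (`|x i 0 + t| - `|x i 0|) - t * v i 0.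
  move=> /hv [d [d0 hd]]; exists d; split => // t td.
  have := hd (x + t *: delta_mx i 0).
  rewrite [x + _ - x]addrC addKr enormZ enorm_delta mulr1 => /(_ td).
  by rewrite -mulrBr l1norm_delta dotZr dot_delta.
have vle : `|v i 0| <= mu.
  rewrite leNgt; apply/negP => h.
  have [|d [d0 hd]] := test ((`|v i 0| - mu) / 2); first lra.
  pose t := Num.sg (v i 0) * (d / 2).
  have v0 : v i 0 != 0 by rewrite -normr_gt0; lra.
  have nt : `|t| = d / 2 by rewrite normrM normr_sg v0 mul1r gtr0_norm; lra.
  have := hd t; rewrite nt => /(_ _); have dd : d / 2 < d by lra.
  move=> /(_ dd); rewrite {2}/t mulrAC -normrEsg.
  have := ler_normD (x i 0) t; rewrite nt; nra.
split=> //; have [->|x0] := eqVneq (x i 0) 0; first by rewrite normr0 !mulr0.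
have ax : 0 < `|x i 0| by rewrite normr_gt0.
apply/eqP; rewrite eq_le; apply/andP; split.
  by apply: le_trans (ler_norm _) _; rewrite normrM ler_pM2r.
rewrite leNgt; apply/negP => h.
have [|d [d0 hd]] := test ((mu - v i 0 * x i 0 / `|x i 0|) / 2).
  by rewrite divr_gt0 // subr_gt0 ltr_pdivrMr.
set e := _ / 2 in hd; have he : e * `|x i 0| * 2 = mu * `|x i 0| - v i 0 * x i 0.
  by rewrite /e; field; rewrite gt_eqF.
(* The cap 1 keeps [1 - r] nonnegative; the other bound keeps the step shorter than [d]. *)
pose r := Num.min (d / `|x i 0| / 2) 1.
have r0 : 0 < r by rewrite lt_min ltr01 andbT divr_gt0 ?divr_gt0.
have r1 : r <= 1 by rewrite ge_min lexx orbT.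
have nt : `|- r * x i 0| = r * `|x i 0| by rewrite normrM normrN (gtr0_norm r0).
have rd : r * `|x i 0| < d.
  have : r <= d / `|x i 0| / 2 by rewrite ge_min lexx.
  rewrite ler_pdivlMr // ler_pdivlMr // => rr; nra.
have := hd (- r * x i 0); rewrite nt => /(_ rd).
have -> : x i 0 + - r * x i 0 = (1 - r) * x i 0 by ring.
rewrite normrM ger0_norm ?subr_ge0 // => k.
have : r * (e * `|x i 0| * 2) <= r * (e * `|x i 0|) by rewrite he; nra.
rewrite ler_pM2l //.
have : 0 < e * `|x i 0| by rewrite mulr_gt0 // /e divr_gt0 // subr_gt0 ltr_pdivrMr.
lra.
Qed.

(** [abs_subgrad] is closed under limits. Conversely, convexity makes the subgradient inequality
    global, so constant sequences are witnesses. *)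
Lemma limiting_subdiff_l1 (n : nat) (mu : R) (x v : 'cV[R]_n) : 0 < mu ->
  limiting_subdiff (fun x => mu * l1norm x) x v <->
  forall i, abs_subgrad mu (v i 0) (x i 0).
Proof.
move=> mu0; split=> [[xs [vs [hx [_ [hv hr]]]]] i|h].
  have {}hx := seq_cvg_coord (i := i) hx; have {}hv := seq_cvg_coord (i := i) hv.
  have {}hr k := regular_subdiff_l1 mu0 (hr k) i; split.
    have hn : (fun k => `|vs k i 0|) @ \oo --> `|v i 0| by exact: cvg_norm.
    by apply: (cvgr_to_le hn); apply: nearW => k; case: (hr k).
  have h1 : (fun k => vs k i 0 * xs k i 0) @ \oo --> v i 0 * x i 0 by exact: cvgM.
  have h2 : (fun k => vs k i 0 * xs k i 0) @ \oo --> mu * `|x i 0|.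
    rewrite (_ : (fun k => _) = (fun k => mu * `|xs k i 0|)); last first.
      by apply/funext => k; case: (hr k).
    by apply: cvgMl_tmp; exact: cvg_norm.
  exact: (cvg_unique _ h1 h2).
exists (fun=> x), (fun=> v).
split; first by move=> e e0; exists 0%N => k _; rewrite subrr enorm0.
split; first exact: cvg_cst.
split; first by move=> e e0; exists 0%N => k _; rewrite subrr enorm0.
move=> _ e e0; exists 1; split => // u _.
apply: le_trans (_ : 0 <= _); first by rewrite mulNr oppr_le0 mulr_ge0 ?enorm_ge0 // ltW.
rewrite /l1norm /dot !mulr_sumr -!sumrB; apply: sumr_ge0 => i _; rewrite !mxE.
by have := abs_subgrad_le (u i 0) (h i); case: (h i) => _; lra.
Qed.

End Subdifferential.

(** * Second-order subdifferential of the l1 norm *)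

Section SecondOrder.
Variables (R : realType) (n : nat) (mu : R).
Hypothesis mu0 : 0 < mu.
Implicit Types (p u : 'cV[R]_(n + n)) (i : 'I_n).

Local Notation gph := (gph_subdiff (fun x : 'cV[R]_n => mu * l1norm x)).

(** Coordinates decouple: the graph is a product of planar curves, each made of two horizontal rays
    joined by a vertical segment. *)
Lemma gph_subdiff_l1 p :
  gph p <-> forall i, abs_subgrad mu (p (rshift n i) 0) (p (lshift n i) 0).
Proof.
split=> [[x [v [/(limiting_subdiff_l1 _ _ mu0) h ->]]] i|h].
  by rewrite col_mxEd col_mxEu.
exists (usubmx p), (dsubmx p); split; last by rewrite vsubmxK.
by apply/(limiting_subdiff_l1 _ _ mu0) => i; rewrite !mxE.
Qed.

(** Along the segment the normal quotient is constantly [s * u j 0]; if that were positive, half of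
    it as tolerance would be violated. *)
Lemma frechet_normal_direction (N : nat) (Om : set 'cV[R]_N) (p u : 'cV[R]_N) j (s : R) :
  `|s| = 1 -> frechet_normal Om p u ->
  (exists r : R, 0 < r /\ forall t, 0 < t < r -> Om (p + (s * t) *: delta_mx j 0)) ->
  s * u j 0 <= 0.
Proof.
move=> s1 hu [r [r0 hr]]; rewrite leNgt; apply/negP => h.
have [|d [d0 hd]] := hu (s * u j 0 / 2); first by rewrite divr_gt0.
pose t := Num.min d r / 2.
have m0 : 0 < Num.min d r by rewrite lt_min d0.
have mr : Num.min d r <= r by rewrite ge_min lexx orbT.
have md : Num.min d r <= d by rewrite ge_min lexx.
have t0 : 0 < t by rewrite divr_gt0.
have := hd _ (hr t _); rewrite [p + _ - p]addrC addKr enormZ enorm_delta.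
rewrite mulr1 normrM s1 mul1r gtr0_norm // dotZr dot_delta.
have tr : 0 < t < r by rewrite t0 /t; lra.
have td : t < d by rewrite /t; lra.
move=> /(_ tr td); nra.
Qed.

Lemma abs_subgrad_lt (a s : R) : abs_subgrad mu a s -> `|a| < mu -> s = 0.
Proof.
case=> _ e h; apply/eqP; rewrite -normr_eq0 eq_le normr_ge0 andbT leNgt.
apply/negP => s0; have := ler_norm (a * s); rewrite normrM e; nra.
Qed.

(** [s'] keeps the nonzero sign of [s], and this sign determines the multiplier. *)
Lemma abs_subgrad_stable (a s a' s' : R) :
  abs_subgrad mu a s -> abs_subgrad mu a' s' -> `|s' - s| < `|s| -> a' = a.
Proof.
move=> [_ e] [_ e']; have m0 := mu0.
have [s0|s0] := leP 0 s; rewrite ltr_norml => /andP[h1 h2].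
  rewrite ger0_norm // in e h1 h2; have s0' : 0 < s' by lra.
  rewrite gtr0_norm // in e'; have s0'' : 0 < s by lra.
  move: e e' => /(mulIf (lt0r_neq0 s0'')) -> /(mulIf (lt0r_neq0 s0')) -> //.
rewrite ltr0_norm // in e h1 h2; have s0' : s' < 0 by lra.
rewrite ltr0_norm // in e'; move: e e'; rewrite !mulrN -!mulNr.
by move=> /(mulIf (ltr0_neq0 s0)) -> /(mulIf (ltr0_neq0 s0')) ->.
Qed.

(** The planar curve is probed both ways along a ray, both ways along the open segment, and at a
    corner one way along each of the two pieces. *)
Lemma frechet_normal_l1_coord p u i : gph p -> frechet_normal gph p u ->
  [/\ p (lshift n i) 0 != 0 -> u (lshift n i) 0 = 0,
      `|p (rshift n i) 0| < mu -> u (rshift n i) 0 = 0 &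
      u (lshift n i) 0 * u (rshift n i) 0 <= 0].
Proof.
move=> /gph_subdiff_l1 hp hu; have m0 := mu0.
set x := p (lshift n i) 0; set v := p (rshift n i) 0.
set a := u (lshift n i) 0; set c := u (rshift n i) 0.
have left_test s : `|s| = 1 ->
    (exists r : R, 0 < r /\ forall t, 0 < t < r -> abs_subgrad mu v (x + s * t)) ->
    s * a <= 0.
  move=> s1 [r [r0 hr]]; apply: (frechet_normal_direction s1 hu).
  exists r; split => // t tr; apply/gph_subdiff_l1 => k.
  rewrite !mxE eq_rlshift eq_lshift /= mulr0 addr0 andbT.
  case: eqP => [->|_]; first by rewrite mulr1; exact: hr.
  by rewrite mulr0 addr0.
have right_test s : `|s| = 1 ->
    (exists r : R, 0 < r /\ forall t, 0 < t < r -> abs_subgrad mu (v + s * t) x) ->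
    s * c <= 0.
  move=> s1 [r [r0 hr]]; apply: (frechet_normal_direction s1 hu).
  exists r; split => // t tr; apply/gph_subdiff_l1 => k.
  rewrite !mxE eq_lrshift eq_rshift /= mulr0 addr0 andbT.
  case: eqP => [->|_]; first by rewrite mulr1; exact: hr.
  by rewrite mulr0 addr0.
have n1 : `|1 : R| = 1 by rewrite normr1.
have nN1 : `|- 1 : R| = 1 by rewrite normrN1.
have sx : abs_subgrad mu v x by exact: hp.
have sg_pos t : 0 <= t -> abs_subgrad mu mu t.
  by move=> t0; split; rewrite ger0_norm // ltW.
have sg_neg t : t <= 0 -> abs_subgrad mu (- mu) t.
  by move=> t0; split; rewrite ?normrN ?(gtr0_norm mu0) ?(ler0_norm t0) ?mulrN ?mulNr.
have sg_zero t : `|t| <= mu -> abs_subgrad mu t 0.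
  by move=> tm; split=> //; rewrite normr0 !mulr0.
have [x0|x0|x0] := ltgtP x 0.
- have ev : v = - mu.
    by case: sx => _; rewrite ltr0_norm // mulrN -mulNr => /(mulIf (ltr0_neq0 x0)).
  have key s : `|s| = 1 -> s * a <= 0.
    move=> s1; apply: left_test => //; exists (- x); split; first by rewrite oppr_gt0.
    move=> t /andP[t0 tx]; rewrite ev; apply: sg_neg.
    by have := ler_norm s; rewrite s1; nra.
  have -> : a = 0 by have := key _ n1; have := key _ nN1; lra.
  by split => //; rewrite ?mul0r // ev normrN gtr0_norm ?ltxx.
- have ev : v = mu.
    by case: sx => _; rewrite gtr0_norm // => /(mulIf (lt0r_neq0 x0)).
  have key s : `|s| = 1 -> s * a <= 0.
    move=> s1; apply: left_test => //; exists x; split => //.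
    move=> t /andP[t0 tx]; rewrite ev; apply: sg_pos.
    by have := ler_norm (- s); rewrite normrN s1; nra.
  have -> : a = 0 by have := key _ n1; have := key _ nN1; lra.
  by split => //; rewrite ?mul0r // ev gtr0_norm ?ltxx.
rewrite x0 in left_test right_test.
have vm : `|v| <= mu by case: sx.
have vm' : - mu <= v <= mu by rewrite -ler_norml.
have [vlt|vgt|vmu] := ltgtP `|v| mu; last first.
(* At a corner the two one-sided moves fix the signs of [a] and [c], which are opposite. *)
- have /orP[/eqP ev|/eqP ev] : (v == mu) || (v == - mu).
    by move/eqP: vmu; rewrite eqr_norml => /andP[].
  + have a0 : 1 * a <= 0.
      apply: left_test => //; exists 1; split => // t /andP[t0 _].
      by rewrite ev; apply: sg_pos; lra.
    have c0 : - 1 * c <= 0.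
      apply: right_test => //; exists mu; split => // t /andP[t0 tm].
      by apply: sg_zero; rewrite ler_norml ev; lra.
    by split => //; nra.
  + have a0 : - 1 * a <= 0.
      apply: left_test => //; exists 1; split => // t /andP[t0 _].
      by rewrite ev; apply: sg_neg; lra.
    have c0 : 1 * c <= 0.
      apply: right_test => //; exists mu; split => // t /andP[t0 tm].
      by apply: sg_zero; rewrite ler_norml ev; lra.
    by split => //; nra.
- by lra.
have key s : `|s| = 1 -> s * c <= 0.
  move=> s1; apply: right_test => //; exists (mu - `|v|); split.
    by rewrite subr_gt0.
  move=> t /andP[t0 tm]; apply: sg_zero; apply: le_trans (ler_normD _ _) _.
  by rewrite normrM s1 mul1r gtr0_norm //; lra.
have -> : c = 0 by have := key _ n1; have := key _ nN1; lra.
by split => //; rewrite mulr0.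
Qed.

(** Off the corners one of the two entries is locked near [p], and [u] vanishes in the other, so [u]
    pairs to exactly zero with nearby graph displacements. *)
Lemma frechet_normal_l1 p u : gph p ->
  (forall i, (p (lshift n i) 0 != 0 /\ u (lshift n i) 0 = 0) \/
             (`|p (rshift n i) 0| < mu /\ u (rshift n i) 0 = 0)) ->
  frechet_normal gph p u.
Proof.
move=> gp h e e0; move: (gp) => /gph_subdiff_l1 hp.
have [| |d [d0 hd]] := @common_radius R 'I_n (fun i d => forall q, gph q ->
  enorm (q - p) < d ->
  u (lshift n i) 0 * (q - p) (lshift n i) 0
  + u (rshift n i) 0 * (q - p) (rshift n i) 0 = 0).
- by move=> i d d' hi dd q gq hq; apply: hi => //; exact: lt_le_trans dd.
- move=> i; have [[x0 u0]|[v0 u0]] := h i.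
    exists `|p (lshift n i) 0|; split; first by rewrite normr_gt0.
    move=> q /gph_subdiff_l1 hq hd; rewrite u0 mul0r add0r !mxE.
    rewrite (@abs_subgrad_stable _ _ _ _ (hp i) (hq i)) ?subrr ?mulr0 //.
    by apply: le_lt_trans hd; apply: le_trans (coord_le_enorm _ (lshift n i)); rewrite !mxE.
  exists (mu - `|p (rshift n i) 0|); split; first by rewrite subr_gt0.
  move=> q /gph_subdiff_l1 hq hd; rewrite u0 mul0r addr0 !mxE.
  rewrite (abs_subgrad_lt (hp i)) // (abs_subgrad_lt (hq i)) ?subrr ?mulr0 //.
  rewrite -[q _ _](subrK (p (rshift n i) 0)); apply: le_lt_trans (ler_normD _ _) _.
  have : `|q (rshift n i) 0 - p (rshift n i) 0| <= enorm (q - p).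
    by apply: le_trans (coord_le_enorm _ (rshift n i)); rewrite !mxE.
  by move: hd; lra.
exists d; split => // q gq hq.
rewrite /dot big_split_ord /= -big_split /= big1 => [|i _]; last exact: hd.
by rewrite mulr_ge0 ?enorm_ge0 // ltW.
Qed.

(** The premises are open conditions and the conclusions closed ones, so the rules for Frechet
    normals pass to the limit. *)
Lemma limiting_normal_l1_coord p u i : limiting_normal gph p u ->
  [/\ p (lshift n i) 0 != 0 -> u (lshift n i) 0 = 0,
      `|p (rshift n i) 0| < mu -> u (rshift n i) 0 = 0 &
      u (lshift n i) 0 * u (rshift n i) 0 <= 0].
Proof.
move=> [ps [us [gps [cp [cu hus]]]]].
have {}hus k := frechet_normal_l1_coord i (gps k) (hus k).
have cpl := seq_cvg_coord (i := lshift n i) cp.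
have cpr := seq_cvg_coord (i := rshift n i) cp.
have cul := seq_cvg_coord (i := lshift n i) cu.
have cur := seq_cvg_coord (i := rshift n i) cu.
split=> [x0|v0|].
- have h0 : (fun k => us k (lshift n i) 0) @ \oo --> (0 : R).
    apply: cvg_near_cst; near=> k.
    case: (hus k) => h _ _; apply/eqP; rewrite h //.
    by near: k; exact: (cvgr_neq0 _ cpl).
  exact: (cvg_unique _ cul h0).
- have h0 : (fun k => us k (rshift n i) 0) @ \oo --> (0 : R).
    apply: cvg_near_cst; near=> k.
    case: (hus k) => _ h _; apply/eqP; rewrite h //.
    by near: k; exact: (cvgr_norm_lt _ cpr).
  exact: (cvg_unique _ cur h0).
- have h0 : (fun k => us k (lshift n i) 0 * us k (rshift n i) 0) @ \oo -->
      u (lshift n i) 0 * u (rshift n i) 0 by exact: cvgM.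
  apply: (cvgr_to_le h0).
  by apply: nearW => k; case: (hus k).
Unshelve. all: by end_near. Qed.

Variable gam : R.
Hypothesis gam0 : 0 < gam.
Implicit Types (y z w : 'cV[R]_n).

Local Notation lam := (gam * mu).

(** Optimality in the proximal problem, rescaled by [gam]; it puts the base point of the Newton
    inclusion on the graph. *)
Lemma scaled_soft_subgrad (t : R) :
  abs_subgrad mu (gam^-1 * (t - soft lam t)) (soft lam t).
Proof.
have [|h1 h2] := @soft_subgrad _ lam _ t; first by rewrite mulr_gt0.
split; first by rewrite normrM gtr0_norm ?invr_gt0 // mulrC ler_pdivrMr // [mu * gam]mulrC.
by rewrite -mulrA h2 -mulrA mulKf ?gt_eqF.
Qed.

Lemma limiting_normal_softv_coord y z w i :
  limiting_normal gph (col_mx (softv lam y) (gam^-1 *: (y - softv lam y)))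
    (col_mx z (- w)) ->
  [/\ lam < `|y i 0| -> z i 0 = 0, `|y i 0| < lam -> w i 0 = 0 &
      0 <= z i 0 * w i 0].
Proof.
have lam0 : 0 < lam by rewrite mulr_gt0.
move=> /(limiting_normal_l1_coord i); rewrite !col_mxEu !col_mxEd !mxE.
move=> [h1 h2 h3]; split=> [yl|yl|]; last by rewrite -oppr_le0 -mulrN.
  exact/h1/soft_neq0.
apply/eqP; rewrite -oppr_eq0; apply/eqP/h2.
rewrite soft_eq0 ?ltW // subr0 normrM gtr0_norm ?invr_gt0 //.
by rewrite mulrC ltr_pdivrMr // mulrC.
Qed.

(* The kinks |y i| = lam are reached from outside, along points of the graph where
   only the multiplier is locked. *)
Lemma limiting_normal_softv y z w :
  (forall i, lam <= `|y i 0| -> z i 0 = 0) ->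
  (forall i, `|y i 0| < lam -> w i 0 = 0) ->
  limiting_normal gph (col_mx (softv lam y) (gam^-1 *: (y - softv lam y)))
    (col_mx z (- w)).
Proof.
move=> hz hw; have lam0 : 0 < lam by rewrite mulr_gt0.
set p := col_mx _ _; set u := col_mx _ _.
(* [a] pushes outward exactly the coordinates with [lam <= |y i|]. There [soft] moves along with
   [y], so the multiplier is unchanged and only the first block of [p] shifts. *)
pose a : 'cV[R]_n := \col_i (if lam <= y i 0 then 1 else if y i 0 <= - lam then -1 else 0).
pose yk k : 'cV[R]_n := y + k.+1%:R^-1 *: a.
pose pk k := col_mx (softv lam (yk k)) (gam^-1 *: (yk k - softv lam (yk k))).
have kpos k : 0 < k.+1%:R^-1 :> R by rewrite invr_gt0 ltr0n.
have soft_yk k i : soft lam (yk k i 0) = soft lam (y i 0) + k.+1%:R^-1 * a i 0.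
  rewrite /yk !mxE; have := kpos k; set r := _^-1 => r0.
  case: ifPn => [h|]; first by rewrite !soft_ge //; lra.
  rewrite -ltNge => h1; case: ifPn => [h|]; first by rewrite !soft_le //; lra.
  by rewrite -ltNge => h2; rewrite mulr0 !addr0.
have pkE k : pk k = p + k.+1%:R^-1 *: col_mx a 0.
  rewrite /p /pk scale_col_mx scaler0 add_col_mx addr0; congr col_mx.
    apply/matrixP => i j; rewrite ord1; have := soft_yk k i.
    by rewrite /yk !mxE.
  congr (_ *: _); apply/matrixP => i j; rewrite ord1; have := soft_yk k i.
  by rewrite /yk !mxE => ->; ring.
have gpk k : gph (pk k).
  apply/gph_subdiff_l1 => i; rewrite /pk col_mxEd col_mxEu !mxE.
  by have := scaled_soft_subgrad (yk k i 0); rewrite !mxE.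
exists pk, (fun=> u); split => //; split.
  move=> e e0; pose b := col_mx a (0 : 'cV[R]_n).
  exists (Num.bound (enorm b / e)) => k hk.
  rewrite pkE [p + _ - p]addrC addKr enormZ gtr0_norm // mulrC ltr_pdivrMr ?ltr0n //.
  rewrite mulrC -ltr_pdivrMr //; apply: lt_trans (archi_boundP _) _.
    by rewrite divr_ge0 ?enorm_ge0 // ltW.
  by rewrite ltr_nat ltnS.
split; first by move=> e e0; exists 0%N => k _; rewrite subrr enorm0.
move=> k; apply: frechet_normal_l1 => // i.
rewrite /pk /u !col_mxEu !col_mxEd !mxE.
have := soft_yk k i; have := kpos k; rewrite /yk !mxE; set r := _^-1 => r0 ->.
have [yl|yl] := leP lam `|y i 0|.
  left; split; last exact: hz.
  case: ifPn => [h|]; first by rewrite soft_ge // mulr1 gt_eqF //; lra.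
  move=> h1; case: ifPn => [h|]; first by rewrite soft_le // lt_eqF //; lra.
  by move=> h2; move: yl; rewrite ler_normr => /orP[] h; lra.
right; split; last by rewrite hw ?oppr0.
move: (yl); rewrite ltr_norml => /andP[h1 h2].
rewrite !leNgt h1 h2 /= mulr0 !addr0 soft_eq0 ?ltW // subr0 normrM gtr0_norm ?invr_gt0 //.
by rewrite mulrC ltr_pdivrMr // mulrC.
Qed.

End SecondOrder.

(** * Damped Newton iteration *)

Section DampedNewton.
Variables (R : realType) (n : nat) (lam : R) (Q : 'M[R]_n) (c : 'cV[R]_n) (k : R).
Hypothesis lam0 : 0 < lam.
Hypothesis Qsym : Q^T = Q.
Hypothesis k0 : 0 < k.
Hypothesis Qcoercive : forall x : 'cV[R]_n, (1 + k) * dot x x <= dot (Q *m x) x.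
Implicit Types (y d h w : 'cV[R]_n).

(** [psi] with the envelope term in closed form; [newton_map] is its gradient. *)
Definition newton_obj y : R :=
  2^-1 * dot ((Q - 1%:M) *m y) y + dot c y + huberv lam y.

Definition newton_map y : 'cV[R]_n := Q *m y - softv lam y + c.

Local Notation f := newton_obj.
Local Notation F := newton_map.

(** The remainder [dot h h / 2] of [huberv_upper] cancels the identity in [Q - 1], leaving the form
    of [Q]. *)
Lemma newton_obj_upper y h : f (y + h) <= f y + dot (F y) h + 2^-1 * dot (Q *m h) h.
Proof.
have := huberv_upper y (y + h) lam0; rewrite [y + h - y]addrC addKr.
have Qyh : dot (Q *m y) h = dot (Q *m h) y by rewrite dot_mulmxl Qsym dotC.
rewrite /f /F !mulmxBl !mul1mx !mulmxDr !dotE Qyh (dotC h y) (dotC c h) (dotC c y); lra.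
Qed.

Lemma newton_obj_lower y h : f y + dot (F y) h + 2^-1 * (k * dot h h) <= f (y + h).
Proof.
have := huberv_lower y (y + h) lam0; rewrite [y + h - y]addrC addKr.
have Qyh : dot (Q *m y) h = dot (Q *m h) y by rewrite dot_mulmxl Qsym dotC.
have := Qcoercive h.
rewrite /f /F !mulmxBl !mul1mx !mulmxDr !dotE Qyh (dotC h y) (dotC c h) (dotC c y); lra.
Qed.

(** By firm nonexpansiveness [softv] absorbs at most one unit of the coercivity [1 + k] of [Q]. *)
Lemma newton_map_monotone y y' : k * dot (y - y') (y - y') <= dot (F y - F y') (y - y').
Proof.
have -> : F y - F y' = Q *m (y - y') - (softv lam y - softv lam y').
  by rewrite /F mulmxBr; apply/matrixP => i j; rewrite !mxE; ring.
have := Qcoercive (y - y'); have := softv_firmly_nonexpansive y y' lam0.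
set p := softv _ _ - _; set h := y - y'; clearbody p h.
by have := dot_ge0 (p - h); rewrite !dotE (dotC h p); lra.
Qed.

Lemma newton_map_expanding y y' :
  k ^+ 2 * dot (y - y') (y - y') <= dot (F y - F y') (F y - F y').
Proof.
have k1 := k0; have := newton_map_monotone y y'.
set h := y - y'; set u := F y - F y'; clearbody h u => m.
have := dot_ge0 (u - k *: h); rewrite !dotE (dotC h u) => m'.
have : k * (k * dot h h) <= k * dot u h by rewrite ler_pM2l.
lra.
Qed.

Lemma newton_map_inj y y' : F y = F y' -> y = y'.
Proof.
move=> e; apply/eqP; rewrite -subr_eq0; apply/eqP/dot_eq0.
have := newton_map_expanding y y'; rewrite e subrr dot0l.
by rewrite pmulr_rle0 // exprn_gt0.
Qed.

Lemma newton_map_lipschitz : exists C : R, 0 < C /\ forall y y',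
  dot (F y - F y') (F y - F y') <= C * dot (y - y') (y - y').
Proof.
have [C [C0 hC]] := quadratic_form_bound (Q^T *m Q).
exists (2 * C + 2); split => [|y y']; first lra.
have -> : F y - F y' = Q *m (y - y') - (softv lam y - softv lam y').
  by rewrite /F mulmxBr; apply/matrixP => i j; rewrite !mxE; ring.
have := hC (y - y'); rewrite -mulmxA dot_mulmxl trmxK.
have := softv_firmly_nonexpansive y y' lam0.
set q := Q *m _; set p := softv _ _ - _; set h := y - y'; clearbody p h q.
have := dot_ge0 (p - h); have := dot_ge0 (q + p).
by rewrite !dotE (dotC h p) (dotC q p); lra.
Qed.

(** Minimizes the strongly convex lower model at [y] over all displacements, by completing a
    square. *)
Lemma newton_obj_bounded_below y y' :
  f y - (2 * k)^-1 * dot (F y) (F y) <= f y'.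
Proof.
have k1 := k0; have := newton_obj_lower y (y' - y); rewrite [y + (_ - _)]addrC subrK.
set h := y' - y; set u := F y; clearbody h u => m.
have := dot_ge0 (u + k *: h); rewrite !dotE (dotC h u) => m'.
have e : dot u u = 2 * k * ((2 * k)^-1 * dot u u).
  by rewrite mulrA mulfV ?mul1r // gt_eqF //; lra.
set v := (2 * k)^-1 * dot u u in e *.
have : 0 <= k * (2 * v + 2 * dot u h + k * dot h h) by lra.
rewrite pmulr_rge0 //; lra.
Qed.

(* Along a minimizing sequence a gradient step shows F -> 0, and F is expanding,
   so the sequence is Cauchy. *)
Lemma newton_map_zero_exists : exists y, F y = 0.
Proof.
have k1 := k0.
have [C [C0 hC]] := quadratic_form_bound Q.
have step y : dot (F y) (F y) <= 2 * C * (f y - f (y - C^-1 *: F y)).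
  have Ci : C * C^-1 = 1 by rewrite mulfV ?gt_eqF.
  have a0 : 0 < C^-1 by rewrite invr_gt0.
  have := newton_obj_upper y (- (C^-1 *: F y)); have := hC (F y).
  set u := F y; set a := C^-1 in Ci a0 *; clearbody u a.
  rewrite mulmxN -scalemxAr !dotE => h1 h2.
  have h3 : a * (a * dot (Q *m u) u) <= a * dot u u.
    rewrite ler_pM2l //; apply: le_trans (_ : a * (C * dot u u) <= _).
      by rewrite ler_pM2l.
    by rewrite mulrA [a * C]mulrC Ci mul1r.
  have h4 : 2^-1 * (a * dot u u) <= f y - f (y - a *: u) by lra.
  have h5 : C * (2^-1 * (a * dot u u)) <= C * (f y - f (y - a *: u)) by rewrite ler_pM2l.
  have : C * (2^-1 * (a * dot u u)) = 2^-1 * dot u u.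
    by rewrite !mulrA [C * _]mulrC -[_ * C * a]mulrA Ci mulr1.
  lra.
pose E := [set f y | y in [set: 'cV[R]_n]].
have Einf : has_inf E.
  split; first by exists (f 0), 0.
  exists (f 0 - (2 * k)^-1 * dot (F 0) (F 0)) => _ [y _ <-].
  exact: newton_obj_bounded_below.
have approx (j : nat) : exists y, dot (F y) (F y) < j.+1%:R^-1.
  have [||_ [y _ <-] hy] := @inf_adherent _ E ((2 * C)^-1 * j.+1%:R^-1) => //.
    by rewrite mulr_gt0 // invr_gt0 ?ltr0n // mulr_gt0.
  exists y; apply: le_lt_trans (step y) _; rewrite -ltr_pdivlMl ?mulr_gt0 //.
  rewrite ltrBlDl; apply: lt_le_trans hy _; rewrite lerD2r.
  by apply: ge_inf; [case: Einf | exists (y - C^-1 *: F y)].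
have [u hu] := choice approx.
have hu' j K : (K <= j)%N -> dot (F (u j)) (F (u j)) < K.+1%:R^-1.
  move=> Kj; apply: lt_le_trans (hu j) _.
  by rewrite lef_pV2 ?posrE ?ltr0n // ler_nat ltnS.
have [e e0|yb hyb] := euclid_complete (u := u).
  have ke : 0 < k ^+ 2 * e ^+ 2 by rewrite mulr_gt0 ?exprn_gt0.
  (* The factor 4 pays for [|a - b|^2 <= 2 |a|^2 + 2 |b|^2]. *)
  exists (Num.bound (4 / (k ^+ 2 * e ^+ 2))); set K := Num.bound _ => i j Ki Kj.
  rewrite enorm_lt // -(ltr_pM2l (exprn_gt0 2 k0)).
  apply: le_lt_trans (newton_map_expanding _ _) _.
  have := hu' _ _ Ki; have := hu' _ _ Kj.
  have : 4 * K.+1%:R^-1 < k ^+ 2 * e ^+ 2.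
    rewrite ltr_pdivrMr ?ltr0n // mulrC -ltr_pdivrMr //.
    apply: lt_trans (archi_boundP _) _; first by rewrite divr_ge0 // ltW.
    by rewrite ltr_nat.
  set a := F (u i); set b := F (u j); clearbody a b; move: (K.+1%:R^-1) => q.
  by have := dot_ge0 (a + b); rewrite !dotE (dotC b a); lra.
(* The same splitting of the square bounds [F yb] by [F (u j)] and the Lipschitz error, each
   contributing at most [e / 2]. *)
exists yb; apply: dot_eq0; have [L [L0 hL]] := newton_map_lipschitz.
apply/ler_addgt0Pr => e e0; rewrite add0r.
have q0 : 0 < e / (4 * L) by rewrite divr_gt0 // mulr_gt0.
have [|K hK] := hyb (Num.sqrt (e / (4 * L))); first by rewrite sqrtr_gt0.
pose j := maxn K (Num.bound (4 / e)).
have := hK j (leq_maxl _ _); rewrite enorm_lt ?sqrtr_gt0 //.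
rewrite (sqr_sqrtr (ltW q0)) ltr_pdivlMr ?mulr_gt0 //.
have := hu' _ _ (leq_maxr K (Num.bound (4 / e))); rewrite -/j.
have : 4 * (Num.bound (4 / e)).+1%:R^-1 < e.
  rewrite ltr_pdivrMr ?ltr0n // mulrC -ltr_pdivrMr //.
  apply: lt_trans (archi_boundP _) _; first by rewrite divr_ge0 // ltW.
  by rewrite ltr_nat.
have := hL (u j) yb; set a := F (u j); set b := F yb; clearbody a b; move: (_.+1%:R^-1) => q.
have := dot_ge0 (a + (a - b)); rewrite !dotE (dotC b a); lra.
Qed.

(** Encodes [w = T d] with [T] diagonal: the product inequality puts [w i] between 0 and [d i], that
    is, the diagonal entry in [0, 1]. *)
Definition newton_direction y d : Prop := forall i,
  let w := (Q *m d + F y) i 0 in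
  [/\ lam < `|y i 0| -> w = d i 0, `|y i 0| < lam -> w = 0 & 0 <= w * (d i 0 - w)].

Lemma newton_direction_dot y d (w := Q *m d + F y) : newton_direction y d ->
  dot w w <= dot w d /\ dot w d <= dot d d.
Proof.
move=> nd; split; apply: ler_sum => i _; case: (nd i) => _ _; rewrite -/w.
  by move: (w i 0) (d i 0) => a b; lra.
by move: (w i 0) (d i 0) => a b; have := sqr_ge0 (a - b); lra.
Qed.

(** [F y = w - Q d], and [dot w d <= dot d d] costs one unit of the coercivity of [Q]. *)
Lemma newton_descent y d : newton_direction y d -> dot (F y) d <= - (k * dot d d).
Proof.
move=> /newton_direction_dot [_]; have := Qcoercive d.
by set u := F y; clearbody u; rewrite !dotE; lra.
Qed.

(** As [F y = w - Q d] with [w] no longer than [d], a short direction forces a small gradient. *)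
Lemma newton_direction_lower : exists C : R, 0 < C /\ forall y d,
  newton_direction y d -> dot (F y) (F y) <= C * dot d d.
Proof.
have [C [C0 hC]] := quadratic_form_bound (Q^T *m Q).
exists (2 * C + 2); split => [|y d /newton_direction_dot]; first lra.
have := hC d; rewrite -mulmxA dot_mulmxl trmxK.
set q := Q *m d; set u := F y; clearbody q u.
by have := dot_ge0 (q + (q + u)); rewrite !dotE (dotC u q); lra.
Qed.

Definition newton_armijo (sigma : R) y d (t : R) : Prop :=
  f (y + t *: d) <= f y + sigma * t * dot (F y) d.

(** For [t <= k / C] the quadratic term of the upper model eats at most half of the linear decrease,
    and [sigma < 2^-1] asks for no more than the other half. The threshold is uniform in [y] and
    [d]. *)
Lemma newton_armijo_small (sigma : R) : sigma < 2^-1 ->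
  exists r : R, [/\ 0 < r, r <= 1 & forall y d t, newton_direction y d ->
    0 < t <= r -> newton_armijo sigma y d t].
Proof.
move=> s2; have [C [C0 hC]] := quadratic_form_bound Q.
have k1 := k0; exists (Num.min 1 (k / C)); split.
- by rewrite lt_min ltr01 divr_gt0.
- by rewrite ge_min lexx.
move=> y d t nd /andP[t0]; rewrite le_min => /andP[t1]; rewrite ler_pdivlMr // => tC.
rewrite /newton_armijo; apply: le_trans (newton_obj_upper _ _) _.
have D := newton_descent nd; have := hC d; rewrite -scalemxAr !dotZr dotZl.
set a := dot (F y) d in D *; set b := dot (Q *m d) d; set e := dot d d in D * => hb.
have e0 : 0 <= e by exact: dot_ge0.
have : t * b <= k * e.
  apply: le_trans (_ : t * (C * e) <= _); first by rewrite ler_pM2l.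
  by rewrite mulrA ler_wpM2r.
move=> h; have : t * (t * b) <= t * (k * e) by rewrite ler_pM2l.
have : t * a <= t * - (k * e) by rewrite ler_pM2l.
have ta : t * a <= 0.
  by rewrite pmulr_rle0 //; apply: le_trans D _; rewrite oppr_le0 mulr_ge0 // ltW.
have : (2^-1 - sigma) * (t * a) <= 0 by rewrite pmulr_rle0 // subr_gt0.
lra.
Qed.

(** With [h = y - yb], the Newton equation reads [Q (h + d) = w + (softv y - softv yb)]. Near [yb]
    the right side pairs with [h + d] to at most [dot (h + d) (h + d)], so coercivity forces
    [h + d = 0]. *)
Lemma newton_full_step yb : F yb = 0 -> exists r : R, 0 < r /\ forall y d,
  newton_direction y d -> enorm (y - yb) < r ->
  y + d = yb /\ f yb = f y + 2^-1 * dot (F y) d.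
Proof.
move=> Fyb; have [r [r0 hr]] := softv_piecewise_affine yb lam0.
exists r; split => // y d nd /hr [hS hH].
have k1 := k0.
have Fy : F y = Q *m (y - yb) - (softv lam y - softv lam yb).
  rewrite -[LHS]subr0 -Fyb /F mulmxBr; apply/matrixP => i j; rewrite !mxE; ring.
have dE : y + d = yb.
  suff : (y - yb) + d = 0 by move=> e; apply/eqP; rewrite -subr_eq0 addrAC e.
  set h := y - yb; apply: dot_eq0.
  have E : Q *m (h + d) = (Q *m d + F y) + (softv lam y - softv lam yb).
    by rewrite Fy mulmxDr -addrA subrK addrC.
  have : dot (Q *m (h + d)) (h + d) <= dot (h + d) (h + d).
    rewrite E; apply: ler_sum => i _; have := nd i; have := hS i.
    rewrite /= /h; set w := Q *m d + F y; clearbody w; rewrite !mxE.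
    move: (w i 0) (d i 0) => a b [s1 s2 s3] [w1 w2 w3].
    have [yl|yl|yl] := ltgtP `|y i 0| lam.
    - by rewrite (w2 yl) (s2 yl) subrr addr0 mul0r -expr2 sqr_ge0.
    - by rewrite (w1 yl) (s1 yl) [b + _]addrC.
    (* On a kink [h i = 0], and what remains is [a * b <= b * b], true since [a] lies between 0 and
       [b]. *)
    - rewrite (s3 yl) !subrr addr0 add0r.
      by have := sqr_ge0 (a - b); lra.
  have := Qcoercive (h + d); set e := dot (h + d) _ => q1 q2.
  have : k * e <= 0 by lra.
  by rewrite pmulr_rle0.
split=> //.
(* The value identity is the trapezoidal rule for [f] between [y] and [yb], with zero slope at
   [yb]. *)
have dh : d = - (y - yb) by rewrite -dE opprB [y + d]addrC addrK.
have Fs : dot (F yb) (y - yb) = 0 by rewrite Fyb dot0l.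
have Qyh : dot (Q *m y) yb = dot (Q *m yb) y by rewrite dot_mulmxl Qsym dotC.
move: Fs hH; rewrite dh /f /F !mulmxBl !mul1mx !dotE Qyh.
rewrite (dotC y yb) ![dot c _]dotC; lra.
Qed.

(** * Backtracking and finite termination *)

Variables (sigma beta : R).
Hypothesis hsigma : 0 < sigma < 2^-1.
Hypothesis hbeta : 0 < beta < 1.

Lemma newton_backtracking y d : newton_direction y d ->
  exists j : nat, newton_armijo sigma y d (beta ^+ j).
Proof.
move=> nd; have /andP[s0 s1] := hsigma; have /andP[b0 b1] := hbeta.
have [r [r0 _ hr]] := newton_armijo_small s1.
have : (fun j => beta ^+ j) @ \oo --> (0 : R) by apply: cvg_expr; rewrite gtr0_norm.
move=> /cvgrPdist_lt /(_ r r0) [j _ /(_ j (leqnn j))].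
rewrite sub0r normrN gtr0_norm ?exprn_gt0 // => hj; exists j; apply: hr => //.
by rewrite exprn_gt0 //= ltW.
Qed.

Definition newton_step (y d : nat -> 'cV[R]_n) (tau : nat -> R) (j : nat) : Prop :=
  (F (y j) = 0 -> y j.+1 = y j) /\
  (F (y j) <> 0 ->
     newton_direction (y j) (d j) /\
     (exists l : nat, tau j = beta ^+ l /\ newton_armijo sigma (y j) (d j) (beta ^+ l) /\
        forall i : nat, (i < l)%N -> ~ newton_armijo sigma (y j) (d j) (beta ^+ i)) /\
     y j.+1 = y j + tau j *: d j).

(** Away from [yb] expansion bounds the gradient below, hence also the direction (by [m]); [eta]
    multiplies the resulting slope bound [k * m] by [sigma] and the smallest accepted step
    [beta * t]. *)
Lemma newton_sufficient_decrease yb (r : R) : F yb = 0 -> 0 < r ->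
  exists eta : R, 0 < eta /\ 
    forall (y d : nat -> 'cV[R]_n) tau j, newton_step y d tau j ->
    r <= enorm (y j - yb) -> f (y j.+1) <= f (y j) - eta.
Proof.
move=> Fyb r0; have /andP[s0 s1] := hsigma; have /andP[b0 b1] := hbeta.
have [t [t0 t1 ht]] := newton_armijo_small s1.
have [C [C0 hC]] := newton_direction_lower.
have k1 := k0; pose m := k ^+ 2 * r ^+ 2 / C.
have m0 : 0 < m by rewrite divr_gt0 // mulr_gt0 ?exprn_gt0.
have e0 := mulr_gt0 (mulr_gt0 s0 (mulr_gt0 b0 t0)) (mulr_gt0 k1 m0).
exists (sigma * (beta * t) * (k * m)); split=> // y d tau j [_ st] rj.
have far : k ^+ 2 * r ^+ 2 <= dot (F (y j)) (F (y j)).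
  have := newton_map_expanding (y j) yb; rewrite Fyb subr0; apply: le_trans.
  rewrite ler_pM2l ?exprn_gt0 // -enorm_sqr ler_pXn2r ?nnegrE ?enorm_ge0 //.
  exact: ltW.
have [|nd [[l [tl [al nl]]] ->]] := st.
  by move=> F0; move: far; rewrite F0 dot0l leNgt mulr_gt0 ?exprn_gt0.
(* For positive [l] the preceding trial was rejected, so it exceeds [t], below which every trial
   passes. *)
have bt : beta * t <= beta ^+ l.
  case: l tl al nl => [_ _ _|l _ _ nl].
    by rewrite expr0 -[leRHS]mulr1 ler_pM // ltW.
  rewrite exprS ler_pM2l // leNgt; apply/negP => lt.
  by apply: (nl l (ltnSn l)); apply: ht => //; rewrite exprn_gt0 // ltW.
rewrite tl; apply: le_trans al _.
have D := newton_descent nd.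
have dm : m <= dot (d j) (d j) 
  by rewrite ler_pdivrMr // [_ * C]mulrC; apply: le_trans far (hC _ _ nd).
have km : k * m <= - dot (F (y j)) (d j).
  by apply: le_trans (_ : k * dot (d j) (d j) <= _); [rewrite ler_pM2l|lra].
have : sigma * (beta * t) * (k * m) <= sigma * beta ^+ l * - dot (F (y j)) (d j).
  apply: ler_pM => //; last by rewrite ler_pM2l.
    by rewrite ltW // !mulr_gt0.
  exact/ltW/mulr_gt0.
lra.
Qed.

Lemma newton_finite_termination (y d : nat -> 'cV[R]_n) (tau : nat -> R) yb :
  F yb = 0 -> (forall j, newton_step y d tau j) ->
  exists K, forall j, (K <= j)%N -> y j = yb.
Proof.
move=> Fyb st; have /andP[s0 s1] := hsigma.
have [r [r0 hr]] := newton_full_step Fyb.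
(* Otherwise the objective would fall by [eta] at every step, against its lower bound [f yb]. *)
have [K hK] : exists K, enorm (y K - yb) < r.
  apply: contrapT => /forallNP far.
  have {}far j : r <= enorm (y j - yb) by rewrite leNgt; apply/negP/far.
  have [eta [eta0 dec]] := newton_sufficient_decrease Fyb r0.
  have bound j : f (y j) <= f (y 0%N) - j%:R * eta.
    elim: j => [|j IH]; first by rewrite mul0r subr0.
    have := dec _ _ _ _ (st j) (far j); rewrite -natr1; lra.
  have low j : f yb <= f (y j).
    have := newton_obj_bounded_below yb (y j); rewrite Fyb dot0l; lra.
  pose N := Num.bound ((f (y 0%N) - f yb) / eta).
  have := bound N; have := low N.
  have : (f (y 0%N) - f yb) / eta < N%:R.
    by apply: archi_boundP; rewrite divr_ge0 ?subr_ge0 // ltW.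
  by rewrite ltr_pdivrMr //; lra.
have next : y K.+1 = yb.
  have [F0|F0] := eqVneq (F (y K)) 0.
    by rewrite (st K).1 //; apply: newton_map_inj; rewrite Fyb.
  have [|nd [[l [tl [_ nl]]] ->]] := (st K).2; first exact/eqP.
  have [e fe] := hr _ _ nd hK.
  (* The unit step realizes half of the slope, which is nonpositive, so [sigma < 2^-1] suffices and
     trial 0 is the accepted one. *)
  have unit_ok : newton_armijo sigma (y K) (d K) (beta ^+ 0).
    rewrite /newton_armijo expr0 scale1r e fe mulr1.
    have a0 : dot (F (y K)) (d K) <= 0.
      apply: le_trans (newton_descent nd) _.
      by rewrite oppr_le0 mulr_ge0 ?dot_ge0 // ltW.
    by rewrite lerD2l; apply: ler_wnM2r => //; exact: ltW.
  case: l tl nl => [-> _|l _ nl]; first by rewrite expr0 scale1r.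
  by case: (nl 0%N (ltn0Sn l)).
exists K.+1; elim=> [//|j IH]; rewrite leq_eqVlt => /orP[/eqP <- //|/IH yj].
by rewrite (st j).1 yj.
Qed.

End DampedNewton.

(** * Lasso *)

(** Adding the growth inequalities at [M v] and [M v'] gives
    [k |M v - M v'|^2 <= <v - v', M v - M v'>]; Cauchy-Schwarz then yields the Lipschitz constant
    [k^-1]. *)
Lemma tilt_stable_strong_min (R : realType) (n : nat) (phi : 'cV[R]_n -> R) xb (k : R) :
  0 < k ->
  (forall v, exists x, forall x',
     phi x - dot v x + 2^-1 * (k * dot (x' - x) (x' - x)) <= phi x' - dot v x') ->
  (forall x, phi xb <= phi x) -> tilt_stable phi xb.
Proof.
move=> k0 /choice[M hM] hxb.
have Muniq v x : phi x - dot v x <= phi (M v) - dot v (M v) -> x = M v.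
  move=> h; apply/eqP; rewrite -subr_eq0; apply/eqP/dot_eq0.
  have := hM v x => h'; have : k * dot (x - M v) (x - M v) <= 0 by lra.
  by rewrite pmulr_rle0.
have M0 : M 0 = xb by apply/esym/Muniq; rewrite !dot0l !subr0.
have Mlip v v' : enorm (M v - M v') <= k^-1 * enorm (v - v').
  have := hM v (M v'); have := hM v' (M v); have := dot_le_enorm (v - v') (M v - M v').
  rewrite -[M v' - M v]opprB dotNl dotNr opprK -enorm_sqr.
  have -> : dot (v - v') (M v - M v') =
      dot v (M v) - dot v (M v') - (dot v' (M v) - dot v' (M v')).
    by rewrite !dotE; ring.
  set s := enorm (M v - M v'); set t := enorm (v - v') => h1 h2 h3.
  have st : k * s ^+ 2 <= t * s by lra.
  have s0 : 0 <= s by exact: enorm_ge0.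
  rewrite mulrC ler_pdivlMr //.
  have [->|sn0] := eqVneq s 0; first by rewrite mul0r enorm_ge0.
  by rewrite -(@ler_pM2r _ s) ?lt_neqAle 1?eq_sym ?sn0 //; lra.
(* With [delta = k] the Lipschitz bound keeps [M v] in the unit ball around [xb], so the minimizer
   over the ball is the global one. *)
exists 1; split => //; exists M, k, k^-1; split => //; split; first by rewrite invr_ge0 ltW.
split; last by split.
move=> v hv; have Mball : enorm (M v - xb) <= 1.
  rewrite -M0; apply: le_trans (Mlip v 0) _; rewrite subr0 mulrC ler_pdivrMr // mul1r.
  exact: ltW.
apply/seteqP; split=> [x [_ /(_ _ Mball) /Muniq //]|x /= ->].
split=> // x' _; apply: le_trans (hM v x').
by rewrite lerDl mulr_ge0 ?invr_ge0 // mulr_ge0 ?dot_ge0 // ltW.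
Qed.

Section Lasso.
Variables (R : realType) (m n : nat) (A : 'M[R]_(m, n)) (mu gam : R).
Hypothesis mu0 : 0 < mu.
Hypothesis gam0 : 0 < gam.
Let Ab := A^T *m A.
Hypothesis Apos : posdef Ab.
Hypothesis IApos : posdef (1%:M - gam *: Ab).
Implicit Types (x y d v bb : 'cV[R]_n).

Let g x : R := mu * l1norm x.
Let Q := gQ Ab gam.
Let lam := gam * mu.

Lemma gram_sym : Ab^T = Ab.
Proof. by rewrite /Ab trmx_mul trmxK. Qed.

Lemma lam_gt0 : 0 < lam.
Proof. exact: mulr_gt0. Qed.

Lemma gQK y : (1%:M - gam *: Ab) *m (Q *m y) = y.
Proof. by rewrite mulmxA mulmxV ?mul1mx // posdef_unitmx. Qed.

Lemma gQ_sym : Q^T = Q.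
Proof. by rewrite /Q /gQ trmx_inv linearB /= linearZ /= trmx1 gram_sym. Qed.

(** For [u = Q x] and [w = Ab u] the form equals [gam (<w, u> - gam |w|^2)]. The square
    [|A u - gam A w|^2 >= 0] and positivity of [1 - gam Ab] at [w] make it positive. *)
Lemma gP_posdef : posdef (gP Ab gam).
Proof.
move=> x x0; pose u := Q *m x.
have xE : x = u - gam *: (Ab *m u).
  by rewrite -{1}[x]gQK mulmxBl mul1mx scalemxAl.
have u0 : u != 0.
  by apply: contra x0 => /eqP u0; rewrite xE u0 mulmx0 scaler0 subr0.
have -> : gP Ab gam *m x = gam *: (Ab *m u).
  by rewrite mulmxBl mul1mx -/u xE opprB addrC subrK.
pose w := Ab *m u; rewrite -/w {1}xE -/w.
have wu : 0 < dot w u by exact: Apos.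
have w0 : w != 0 by apply: contraTneq wu => ->; rewrite dot0l ltxx.
have := IApos w0; rewrite mulmxBl mul1mx -scalemxAl.
have Aw : dot (Ab *m w) w = dot (A *m w) (A *m w).
  by rewrite -mulmxA dot_mulmxl trmxK.
have wuE : dot w u = dot (A *m u) (A *m u).
  by rewrite /w -mulmxA dot_mulmxl trmxK.
have wwE : dot w w = dot (A *m u) (A *m w).
  by rewrite {1}/w -mulmxA dot_mulmxl trmxK.
have g0 := gam0.
rewrite dotBl !dotZl dotBr dotZr Aw => h.
rewrite mulr_gt0 // wuE.
have := dot_ge0 (A *m u - gam *: (A *m w)).
rewrite !(dotBl, dotBr, dotZl, dotZr) (dotC (A *m w)) -wwE.
have : 0 < gam * (dot w w - gam * dot (A *m w) (A *m w)) by rewrite mulr_gt0.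
lra.
Qed.

Lemma gQ_coercive : exists k : R, 0 < k /\
  forall x, (1 + k) * dot x x <= dot (Q *m x) x.
Proof.
have [|k [k0 hk]] := posdef_coercive _ gP_posdef.
  by rewrite linearB /= gQ_sym trmx1.
exists k; split => // x; have := hk x; rewrite mulmxBl mul1mx dotBl -/Q; lra.
Qed.

Lemma grad_psi_l1 bb y : grad_psi Ab bb g gam y = newton_map lam Q (gc Ab bb gam) y.
Proof. by rewrite /grad_psi prox_l1. Qed.

Lemma psi_l1 bb y : psi Ab bb g gam y = newton_obj lam Q (gc Ab bb gam) y.
Proof. by rewrite /psi moreau_l1. Qed.

(** Rests on [d = gam z + w], which turns the sign condition on [z] and [w] into the one on [w] and
    [d - w]. *)
Lemma newton_dir_direction bb y d : newton_dir Ab bb g gam y d ->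
  newton_direction lam Q (gc Ab bb gam) y d.
Proof.
rewrite /newton_dir /= prox_l1 // grad_psi_l1 => nd i /=.
have := limiting_normal_softv_coord mu0 gam0 i nd.
rewrite -/Q; set F := newton_map _ _ _ _; set w := Q *m d + F.
set z := gam^-1 *: _.
have g0 := gam0.
have -> : d i 0 = gam * z i 0 + w i 0.
  rewrite /z [in RHS]mxE mulrA mulfV ?gt_eqF // mul1r /w /gP -/Q mulmxBl mul1mx.
  by rewrite !mxE; ring.
move: (z i 0) (w i 0) => a b [h1 h2 h3]; split=> [/h1 ->|/h2 ->|] //.
  by rewrite mulr0 add0r.
by rewrite addrK mulrCA mulr_ge0 1?mulrC // ltW.
Qed.

Lemma newton_dir_exists bb y : exists d, newton_dir Ab bb g gam y d.
Proof.
have [k [k0 hk]] := gQ_coercive.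
(* Kinks get the entry 1, since [limiting_normal_softv] asks for [z i = 0] there. *)
pose T : 'M[R]_n := diag_mx (\row_i (if lam <= `|y i 0| then 1 else 0)).
have TE d i : (T *m d) i 0 = (if lam <= `|y i 0| then 1 else 0) * d i 0.
  by rewrite /T mul_diag_mx !mxE.
have QTpos : posdef (Q - T).
  move=> x x0; have xx := dot_gt0 x0.
  have : dot (T *m x) x <= dot x x.
    apply: ler_sum => i _; rewrite TE; case: ifP => _; rewrite ?mul1r // !mul0r.
    by rewrite -expr2 sqr_ge0.
  have := hk x; have := mulr_gt0 k0 xx; rewrite mulmxBl dotBl; lra.
set F := newton_map lam Q (gc Ab bb gam) y.
pose d := invmx (Q - T) *m (- F); exists d.
have dE : Q *m d + F = T *m d.
  have : (Q - T) *m d = - F by rewrite mulmxA mulmxV ?mul1mx // posdef_unitmx.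
  by rewrite mulmxBl => /(canRL (subrK _)) ->; rewrite addrAC addNr add0r.
rewrite /newton_dir /= prox_l1 // grad_psi_l1 -/Q -/F.
apply: limiting_normal_softv => // i yi.
  have aux (a q u : 'cV[R]_n) : (q + u) i 0 = a i 0 ->
      (gam^-1 *: (- u - (q - a))) i 0 = 0.
    by rewrite !mxE => <-; ring.
  by rewrite /gP -/Q mulmxBl mul1mx; apply: aux; rewrite dE TE yi mul1r.
by rewrite dE TE leNgt yi mul0r.
Qed.

(** The linear term is left free so that tilted problems stay in one family. *)
Definition quad_l1 bb x : R := 2^-1 * dot (Ab *m x) x + dot bb x + mu * l1norm x.

(** The zero of the Newton map makes [xb] the prox of [yb], so [v] is a subgradient of the l1 term
    at [xb]; undoing [Q] identifies [v] with minus the gradient of the quadratic part. *)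
Lemma quad_l1_strong_min bb yb (xb := Q *m yb + gc Ab bb gam) :
  newton_map lam Q (gc Ab bb gam) yb = 0 ->
  forall x, quad_l1 bb xb + 2^-1 * dot (Ab *m (x - xb)) (x - xb) <= quad_l1 bb x.
Proof.
move=> Fyb x; have g0 := gam0.
have xbE : xb = softv lam yb.
  by apply/eqP; rewrite -subr_eq0 /xb addrAC; apply/eqP.
pose v := gam^-1 *: (yb - xb).
have vE : v = - (Ab *m xb + bb).
  have : (1%:M - gam *: Ab) *m xb = yb + gam *: bb.
    by rewrite /xb mulmxDr gQK /gc -scalemxAr gQK.
  have aux (a x' s t : 'cV[R]_n) : x' - s = a + t -> a - x' = - (s + t).
    by move=> e; rewrite -[a](addrK t) -e; apply/matrixP => i j; rewrite !mxE; ring.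
  rewrite mulmxBl mul1mx -scalemxAl => /aux; rewrite /v => ->.
  by rewrite -scalerDr scalerN scalerA mulVf ?gt_eqF // scale1r.
have sub : mu * l1norm xb + dot v (x - xb) <= mu * l1norm x.
  rewrite /l1norm /dot !mulr_sumr -big_split /=; apply: ler_sum => i _.
  have sg := scaled_soft_subgrad mu0 gam0 (yb i 0).
  have := abs_subgrad_le (x i 0) sg; case: sg => _.
  by rewrite /v xbE !mxE; set a := gam^-1 * _; lra.
have sym : dot (Ab *m x) xb = dot (Ab *m xb) x by rewrite dot_mulmxl gram_sym dotC.
move: sub; rewrite vE; clearbody xb; rewrite /quad_l1 mulmxBr !dotE sym; lra.
Qed.

(** The modulus precedes [bb], hence is uniform over tilts; each minimizer comes from a zero of the
    Newton map. *)
Lemma quad_l1_strong_min_exists : exists k : R, 0 < k /\ forall bb, exists xb, forall x,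
  quad_l1 bb xb + 2^-1 * (k * dot (x - xb) (x - xb)) <= quad_l1 bb x.
Proof.
have [k [k0 hk]] := posdef_coercive gram_sym Apos; exists k; split => // bb.
have [kq [kq0 hkq]] := gQ_coercive.
have [yb Fyb] := newton_map_zero_exists (gc Ab bb gam) lam_gt0 gQ_sym kq0 hkq.
exists (Q *m yb + gc Ab bb gam) => x; apply: le_trans (quad_l1_strong_min Fyb x).
by rewrite lerD2l ler_pM2l ?invr_gt0.
Qed.

Lemma lasso_tilt (b : 'cV[R]_m) v x :
  lasso A b mu x - dot v x = quad_l1 (- (A^T *m b) - v) x + 2^-1 * dot b b.
Proof.
have e1 : dot (Ab *m x) x = dot (A *m x) (A *m x).
  by rewrite -mulmxA dot_mulmxl trmxK.
have e2 : dot (A^T *m b) x = dot b (A *m x) by rewrite dot_mulmxl trmxK.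
rewrite /lasso /quad_l1 enorm_sqr e1.
rewrite !(dotBl, dotBr, dotNl) e2 (dotC (A *m x) b); lra.
Qed.

Variables (sigma beta : R).
Hypothesis hsigma : 0 < sigma < 2^-1.
Hypothesis hbeta : 0 < beta < 1.

Lemma gdna_line_search bb y d : newton_dir Ab bb g gam y d ->
  exists j : nat, armijo Ab bb g sigma gam y d (beta ^+ j).
Proof.
have [k [k0 hk]] := gQ_coercive.
move=> /newton_dir_direction /(newton_backtracking lam_gt0 gQ_sym k0 hk hsigma hbeta) [j hj].
by exists j; rewrite /armijo !psi_l1 grad_psi_l1.
Qed.

Lemma gdna_finite_termination bb (y d : nat -> 'cV[R]_n) (tau : nat -> R) :
  (forall j, gdna_step Ab bb g sigma beta gam y d tau j) ->
  exists yb, newton_map lam Q (gc Ab bb gam) yb = 0 /\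
    exists K, forall j, (K <= j)%N -> y j = yb.
Proof.
move=> st; have [k [k0 hk]] := gQ_coercive.
have [yb Fyb] := newton_map_zero_exists (gc Ab bb gam) lam_gt0 gQ_sym k0 hk.
exists yb; split => //.
apply: (@newton_finite_termination _ _ lam Q (gc Ab bb gam) k lam_gt0 gQ_sym k0 hk
  sigma beta hsigma hbeta y d tau) => // j.
have aE t : armijo Ab bb g sigma gam (y j) (d j) t =
    newton_armijo lam Q (gc Ab bb gam) sigma (y j) (d j) t.
  by rewrite /armijo !psi_l1 grad_psi_l1.
have [st0 st1] := st j; rewrite grad_psi_l1 in st0 st1; split => // /st1.
move=> [nd [[l [tl [al nl]]] yE]]; split; first exact: newton_dir_direction.
split=> //; exists l; split => //; split; first by rewrite -aE.
by move=> i /nl; rewrite aE.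
Qed.

End Lasso.

(** * Superlinear convergence and tilt stability of the limit *)

Lemma eventually_const_Qsuperlinear (R : realType) (n : nat) (y : nat -> 'cV[R]_n) yb K :
  (forall j, (K <= j)%N -> y j = yb) -> seq_cvg y yb /\ Qsuperlinear y yb.
Proof.
move=> yK; split=> [e e0|].
  by exists K => j /yK ->; rewrite subrr enorm0.
(* Past [K] the numerator vanishes, so the quotient is 0 although its denominator is 0 too. *)
apply: cvg_near_cst; exists K => // j /= Kj; apply/eqP.
by rewrite yK ?subrr ?enorm0 ?mul0r // (leq_trans Kj).
Qed.

Theorem theorem6p2 (R : realType) (m n : nat) (A : 'M[R]_(m, n)) (b : 'cV[R]_m)
  (mu : R) (hmu : 0 < mu) (hA : posdef (A^T *m A))
  (sigma beta gam : R) (hsigma : 0 < sigma < 2^-1) (hbeta : 0 < beta < 1)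
  (hgam : 0 < gam) (hIA : posdef (1%:M - gam *: (A^T *m A))) :
  let Ab := A^T *m A in
  let bb := - (A^T *m b) in
  let g := fun x : 'cV[R]_n => mu * l1norm x in
  let phi := lasso A b mu in
  (* (i-a) well-definedness: after any finite number of steps, if the stopping
     test fails, a Newton direction exists and for every such direction the
     backtracking line search terminates *)
  (forall (y d : nat -> 'cV[R]_n) (tau : nat -> R) (K : nat),
     (forall k, (k < K)%N -> gdna_step Ab bb g sigma beta gam y d tau k) ->
     grad_psi Ab bb g gam (y K) <> 0 ->
     (exists d', newton_dir Ab bb g gam (y K) d') /\
     (forall d', newton_dir Ab bb g gam (y K) d' ->
        exists j : nat, armijo Ab bb g sigma gam (y K) d' (beta ^+ j))) /\
  (* (i-b) and (ii): every run converges Q-superlinearly to some ybar, and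
     xbar := Q ybar + c is the unique Lasso solution and tilt-stable *)
  (forall (y d : nat -> 'cV[R]_n) (tau : nat -> R),
     (forall k, gdna_step Ab bb g sigma beta gam y d tau k) ->
     exists ybar : 'cV[R]_n,
       seq_cvg y ybar /\ Qsuperlinear y ybar /\
       let xbar := gQ Ab gam *m ybar + gc Ab bb gam in
       (forall x, phi xbar <= phi x) /\
       (forall x', (forall x, phi x' <= phi x) -> x' = xbar) /\
       tilt_stable phi xbar).
Proof.
move=> Ab bb g phi; split=> [y d tau K _ _|y d tau st].
  split; first exact: newton_dir_exists.
  by move=> d'; exact: gdna_line_search.
have [yb [Fyb [K yK]]] :=
  gdna_finite_termination hmu hgam hA hIA hsigma hbeta st.
exists yb; have [cvg_y super_y] := eventually_const_Qsuperlinear yK.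
split=> //; split=> //; move=> xb.
have [k [k0 hk]] := posdef_coercive (gram_sym A) hA.
have phiE x : phi x = quad_l1 A mu bb x + 2^-1 * dot b b.
  by have := lasso_tilt A mu b 0 x; rewrite dot0l !subr0.
have strong x : phi xb + 2^-1 * (k * dot (x - xb) (x - xb)) <= phi x.
  rewrite !phiE addrAC lerD2r.
  apply: le_trans (quad_l1_strong_min hmu hgam hIA Fyb x).
  by rewrite lerD2l ler_pM2l ?invr_gt0.
have xb_min x : phi xb <= phi x.
  apply: le_trans (strong x); rewrite lerDl mulr_ge0 ?invr_ge0 //.
  by rewrite mulr_ge0 ?dot_ge0 // ltW.
split=> //; split=> [x' hx'|].
  apply/eqP; rewrite -subr_eq0; apply/eqP/dot_eq0.
  have := strong x'; have := hx' xb => h1 h2.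
  have : k * dot (x' - xb) (x' - xb) <= 0 by lra.
  by rewrite pmulr_rle0.
have [kq [kq0 hq]] := quad_l1_strong_min_exists hmu hgam hA hIA.
(* Tilting [phi] by [v] replaces [bb] by [bb - v], with the same modulus [kq]. *)
apply: (tilt_stable_strong_min kq0) => // v.
have [x hx] := hq (bb - v); exists x => x'.
by rewrite !lasso_tilt -/bb; have := hx x'; lra.
Qed.
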